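(* Let $m,n\ge 2$ be integers and let $\Gamma$ be a locally compact group acting properly and cocompactly on the Diestel-Leader graph $\mathrm{DL}(m,n)$. Then there is a positive integer $d$ such that $\Gamma$ acts properly and transitively on $\mathrm{DL}(m^d,n^d)$.
   Context: For an integer $q\ge 1$, $T_q$ is the $(q+1)$-regular tree with a fixed end $-\infty$. For vertices $x,y$, let $\widehat{xy}$ be the vertex at which the rays from $x$ and from $y$ to $-\infty$ merge. With a base vertex $o$, the Busemann function is $b(x)=d(x,\widehat{xo})-d(o,\widehat{xo})\in\mathbf{Z}$; each vertex $x$ has one neighbour (its parent) with $b$-value $b(x)-1$ and $q$ neighbours (its children) with $b$-value $b(x)+1$. Given $T_m,T_n$ with Busemann functions $b,b'$, the Diestel-Leader graph $\mathrm{DL}(m,n)$ has vertex set $\{(x,y)\in T_m\times T_n: b(x)+b'(y)=0\}$ (pairs of vertices), with $(x,y)$ and $(x',y')$ joined by an edge iff $\{x,x'\}$ is an edge of $T_m$ and $\{y,y'\}$ is an edge of $T_n$. It is a connected, locally finite graph. Actions of locally compact groups on locally finite graphs are continuous actions by graph automorphisms; such an action is proper iff vertex stabilizers are compact (and open), cocompact iff there are finitely many vertex orbits, and transitive iff it is transitive on vertices. Actions are not assumed faithful. *)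

(* Defs.v *)
From HB Require Import structures.
From mathcomp Require Import all_boot all_order all_algebra.
From mathcomp Require Import boolp classical_sets functions cardinality.
From mathcomp Require Import filter topology.

Set Implicit Arguments.
Unset Strict Implicit.
Unset Printing Implicit Defensive.

Import Order.TTheory GRing.Theory Num.Theory.

Local Open Scope classical_set_scope.
Local Open Scope card_scope.

Record graph := Graph {
  vertex :> choiceType;
  adj : rel vertex;
  adj_sym : symmetric adj;
  adj_irr : irreflexive adj
}.

Arguments adj {g} : simpl never.

Section GraphNotions.
Variable X : graph.
Implicit Types (x y : X) (r s : nat -> X).

Definition connected_graph := forall x y, exists2 p, path adj x p & last x p = y.

(* Every cycle without repeated vertex is degenerate: the cycles of size 2
   admitted here are those that go back and forth along a single edge. *)
Definition acyclic_graph := forall c : seq X, ucycle adj c -> (size c <= 2)%N.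

Definition tree := connected_graph /\ acyclic_graph.

Definition regular (k : nat) := forall x, [set y | adj x y] #= `I_k.

Definition joined_in x y (k : nat) :=
  exists p, [/\ path adj x p, last x p = y & size p = k].

(* The value is 0 if x and y lie in different components. *)
Definition dist x y : nat :=
  xget 0%N [set k | joined_in x y k /\ forall l, joined_in x y l -> (k <= l)%N].

Definition ray r := injective r /\ forall i, adj (r i) (r i.+1).

Definition cofinal r s := exists i j, forall k, r (i + k)%N = s (j + k)%N.

(* Ends in the sense appropriate for trees: classes of cofinal rays. *)
Definition is_end (E : set (nat -> X)) :=
  exists2 r, ray r & E = [set s | ray s /\ cofinal r s].

End GraphNotions.

(* [ended_tree q] collects all models of T_q: a (q+1)-regular tree together
   with a choice of the end -oo and of the base vertex o. *)
Record ended_tree (q : nat) := EndedTree {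
  et_graph :> graph;
  et_tree : tree et_graph;
  et_regular : regular et_graph q.+1;
  minus_infty : set (nat -> et_graph);
  minus_infty_end : is_end minus_infty;
  base : et_graph
}.

Arguments minus_infty {q} e.
Arguments base {q} e.

Section Busemann.
Variables (q : nat) (T : ended_tree q).
Implicit Types x y z : T.

Definition ray_to_end x (r : nat -> T) := minus_infty T r /\ r 0%N = x.

Definition is_merge x y z := exists r s,
  [/\ ray_to_end x r, ray_to_end y s &
      exists i j, [/\ r i = z, s j = z &
        forall i' j', r i' = s j' -> (i <= i')%N /\ (j <= j')%N]].

(* The default [base T] is never used: [is_merge x y] has exactly one element. *)
Definition merge x y : T := xget (base T) (is_merge x y).

Definition busemann x : int :=
  ((dist x (merge x (base T)))%:Z - (dist (base T) (merge x (base T)))%:Z)%R.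

End Busemann.

(* A model of T_q for q = p.+1. Fix a ray r_0, r_1, ... to -oo. The pair (i, w)
   is the vertex reached from r_i by going down along the word w, read from
   right to left; for i > 0 the first step 0 leads back to r_(i-1) and is
   therefore excluded. *)
Module WordTree.
Section WordTree.
Variable p : nat.
Let word := seq 'I_p.+1.
Let pre := (nat * word)%type.

Definition valid (u : pre) :=
  [|| u.1 == 0%N, u.2 == [::] | last ord0 u.2 != ord0].

Definition V := {u : pre | valid u}.

Definition ppar (u : pre) : pre :=
  if u.2 is _ :: w then (u.1, w) else (u.1.+1, [::]).

Definition pch (u : pre) (a : 'I_p.+1) : pre :=
  if [&& u.2 == [::], (0 < u.1)%N & a == ord0] then (u.1.-1, [::])
  else (u.1, a :: u.2).

Lemma ppar_valid u : valid u -> valid (ppar u).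
Proof.
by case: u => [i [|a [|b w]]]; rewrite /valid /ppar /= ?orbT //.
Qed.

Lemma pch_valid u a : valid u -> valid (pch u a).
Proof.
case: u => [i [|b w]]; rewrite /valid /pch //=.
by case: (posnP i) => [->//|i0]; case: (eqVneq a ord0) => [->|a0] /=;
  rewrite ?orbT ?a0 ?orbT.
Qed.

Lemma pchK u a : ppar (pch u a) = u.
Proof.
case: u => [i [|b w]] //; rewrite /pch /=.
by case: ifP => // /andP[i0 _]; rewrite /ppar /= prednK.
Qed.

Lemma pch_inj u : injective (pch u).
Proof.
case: u => i w a b; rewrite /pch /=.
case: ifP => [/and3P[_ _ /eqP->]|_]; case: ifP => [/and3P[_ _ /eqP->]|_] //;
  by case.
Qed.

Lemma ppar_ch u v : valid v -> ppar v = u -> exists a, v = pch u a.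
Proof.
case: v => [i [|a w]] v_val <-; rewrite /ppar /pch /=.
  by exists ord0.
exists a; case: ifP => // /and3P[/eqP w0 i0 /eqP a0]; move: v_val i0.
by rewrite w0 a0 /valid /= orbF => /eqP ->.
Qed.

Definition par (u : V) : V := exist _ (ppar (val u)) (ppar_valid (valP u)).
Definition ch (u : V) a : V := exist _ (pch (val u) a) (pch_valid a (valP u)).

Lemma chK u a : par (ch u a) = u.
Proof. by apply: val_inj; rewrite /= pchK. Qed.

Definition plev (u : pre) : int := ((size u.2)%:Z - u.1%:Z)%R.
Definition lev (u : V) := plev (val u).

Lemma lev_par u : lev (par u) = (lev u - 1)%R.
Proof.
rewrite /lev /plev /=; case: (val u) => [i [|a w]] /=.
  by rewrite -addn1 PoszD opprD addrA.
by rewrite -[(size w).+1]addn1 PoszD addrAC addrK.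
Qed.

Lemma lev_par_lt u : (lev (par u) < lev u)%R.
Proof. by rewrite lev_par ltrBlDr ltrDl. Qed.

Definition wadj : rel V := fun u v => (par u == v) || (par v == u).

Lemma wadj_sym : symmetric wadj.
Proof. by move=> u v; rewrite /wadj orbC. Qed.

Lemma wadj_irr : irreflexive wadj.
Proof.
move=> u; rewrite /wadj orbb; apply/eqP => /(congr1 lev) e.
by have := lev_par_lt u; rewrite e ltxx.
Qed.

Definition G : graph := Graph wadj_sym wadj_irr.

Let linked (u v : G) := exists2 c, path adj u c & last u c = v.

Lemma linked_trans u v w : linked u v -> linked v w -> linked u w.
Proof.
move=> [c uc <-] [d vd <-]; exists (c ++ d); last by rewrite last_cat.
by rewrite cat_path uc.
Qed.

Lemma linked1 (u v : G) : adj u v -> linked u v.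
Proof. by move=> uv; exists [:: v]; rewrite //= uv. Qed.

Lemma linked_sym u v : linked u v -> linked v u.
Proof.
move=> [c]; elim: c u => [|w c IH] u /=.
  by move=> _ ->; exists [::].
move=> /andP[uw wc] cv; apply: linked_trans (IH _ wc cv) _.
by apply: linked1; rewrite adj_sym.
Qed.

Definition spine i : G := exist _ (i, [::] : word) (orbT _).

Lemma par_spine i : par (spine i) = spine i.+1.
Proof. exact: val_inj. Qed.

Lemma adj_par (u : G) : adj u (par u).
Proof. by rewrite /adj /= /wadj eqxx. Qed.

Lemma linked_spine (u : G) : exists i, linked u (spine i).
Proof.
case: u => [[i w]]; elim: w => [|a w IH] uv.
  exists i; exists [::] => //=; exact: val_inj.
have [j hj] := IH (ppar_valid uv); exists j.
by apply: linked_trans hj; apply/linked1/adj_par.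
Qed.

Lemma spine_linked i k : linked (spine i) (spine (i + k)).
Proof.
elim: k => [|k IH]; first by rewrite addn0; exists [::].
apply: linked_trans IH _; apply: linked1.
by rewrite addnS -par_spine; exact: adj_par.
Qed.

Lemma G_connected : connected_graph G.
Proof.
move=> u v; have [i ui] := linked_spine u; have [j vj] := linked_spine v.
apply: linked_trans (linked_trans ui (spine_linked i j)) _.
by rewrite addnC; apply: linked_sym; apply: linked_trans vj (spine_linked j i).
Qed.

Lemma lev_max (c : seq V) : c != [::] ->
  exists2 u, u \in c & {in c, forall v, (lev v <= lev u)%R}.
Proof.
elim: c => // a [|b c] IH _.
  by exists a; rewrite ?mem_head // => v; rewrite inE => /eqP->.
have [u uc umax] := IH isT; case: (leP (lev a) (lev u)) => au.
  by exists u => [|v]; rewrite inE ?uc ?orbT // => /orP[/eqP->|/umax].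
exists a => [|v]; first exact: mem_head.
rewrite inE => /orP[/eqP->//|/umax vu]; exact: le_trans vu (ltW au).
Qed.

Lemma G_acyclic : acyclic_graph G.
Proof.
move=> c; case: (eqVneq c [::]) => [->//|c0] /andP[cyc unq].
have [u uc umax] := lev_max c0.
have [i d cd] := rot_to uc.
have {}umax v : v \in u :: d -> (lev v <= lev u)%R by rewrite -cd mem_rot => /umax.
move: cyc unq; rewrite -(rot_cycle i) -(rot_uniq i) -(size_rot i) cd.
case: d umax {cd} => [|v [|w d]] // umax; rewrite leqNgt => cyc unq; exfalso.
have low x : x \in [:: u, v, w & d] -> (@adj G) u x -> par u = x.
  move=> xin /orP[/eqP//|/eqP ux]; have := umax _ xin.
  by rewrite -{1}ux leNgt -{1}ux lev_par_lt.
move: cyc; rewrite /= rcons_path => /and3P[uv _ /andP[_ lu]].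
have e1 : par u = v by apply: low => //; rewrite !inE eqxx orbT.
have lin : last w d \in w :: d by exact: mem_last.
have e2 : par u = last w d.
  by apply: low; rewrite 1?adj_sym // 2!inE lin !orbT.
move: unq; rewrite /= => /and3P[_ + _].
by rewrite -e1 e2 lin.
Qed.

Lemma G_regular : regular G p.+2.
Proof.
move=> u; pose s : seq G := par u :: [seq ch u a | a <- enum 'I_p.+1].
have us : uniq s.
  rewrite /= map_inj_uniq ?enum_uniq ?andbT => [|a b /(congr1 val)]; last first.
    exact: pch_inj.
  apply/mapP => -[a _ /(congr1 lev) e].
  have := lev_par_lt (ch u a); rewrite chK -e ltNge => /negP; apply.
  exact/ltW/lev_par_lt.
have sE v : adj u v = (v \in s).
  rewrite inE [v == _]eq_sym; congr orb; apply/eqP/mapP => [|[a _ ->]]; last exact: chK.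
  move=> /(congr1 val) /(ppar_ch (valP v)) [a va].
  by exists a; rewrite ?mem_enum //; exact: val_inj.
have sz : size s = p.+2 by rewrite /= size_map size_enum_ord.
rewrite -sz {sz}; move: s us sE => s us sE.
apply/card_set_bijP; exists (index^~ s); split.
- by move=> v /=; rewrite sE index_mem.
- move=> v w /set_mem /=; rewrite sE => vs /set_mem /=; rewrite sE => ws; exact: index_inj.
- move=> i /= i_s; exists (nth u s i); last exact: index_uniq.
  by rewrite /= sE mem_nth.
Qed.

Lemma spine_ray : ray spine.
Proof.
split=> [i j /(congr1 val) []//|i].
by rewrite -par_spine; exact: adj_par.
Qed.

End WordTree.
End WordTree.

Lemma ended_tree_inhabited (q : nat) : (0 < q)%N -> inhabited (ended_tree q).
Proof.
case: q => // p _; split.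
apply: (@EndedTree _ (WordTree.G p) _ _
  [set s | ray s /\ cofinal (@WordTree.spine p) s] _ (WordTree.spine p 0)).
- by split; [exact: WordTree.G_connected | exact: WordTree.G_acyclic].
- exact: WordTree.G_regular.
- by exists (@WordTree.spine p); first exact: WordTree.spine_ray.
Qed.

Section DiestelLeader.
Variables (m n : nat) (T : ended_tree m) (T' : ended_tree n).

Definition DL_vertex := {p : T * T' | (busemann p.1 + busemann p.2 == 0)%R}.

Definition DL_adj : rel DL_vertex := fun u v =>
  adj (val u).1 (val v).1 && adj (val u).2 (val v).2.

Lemma DL_adj_sym : symmetric DL_adj.
Proof. by move=> u v; congr andb; exact: adj_sym. Qed.

Lemma DL_adj_irr : irreflexive DL_adj.
Proof. by move=> u; rewrite /DL_adj adj_irr. Qed.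

Definition DL : graph := Graph DL_adj_sym DL_adj_irr.

End DiestelLeader.

HB.mixin Record isTopologicalGroup G of Group G & Topological G := {
  mulg_continuous : continuous (fun p : G * G => (p.1 * p.2)%g);
  invg_continuous : continuous (fun g : G => (g^-1)%g)
}.

#[short(type="topologicalGroupType")]
HB.structure Definition TopologicalGroup :=
  {G of Group G & Topological G & isTopologicalGroup G}.

Record graph_action (G : topologicalGroupType) (X : graph) := GraphAction {
  act :> G -> X -> X;
  act1 : forall x, act 1%g x = x;
  actM : forall g h x, act (g * h)%g x = act g (act h x);
  act_adj : forall g x y, adj (act g x) (act g y) = adj x y;
  act_continuous :
    continuous (fun p : G * discrete_topology X =>
                  act p.1 p.2 : discrete_topology X)
}.

Section Actions.
Variables (G : topologicalGroupType) (X : graph) (A : graph_action G X).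

Definition stabilizer (x : X) : set G := [set g | A g x = x].

Definition orbit (x : X) : set X := range (fun g : G => A g x).

Definition proper_action :=
  forall x, compact (stabilizer x) /\ open (stabilizer x).

Definition cocompact_action := finite_set (range orbit).

Definition transitive_action := forall x y : X, exists g, A g x = y.

End Actions.

(* Main.v *)
(* An automorphism of DL(m,n), m, n >= 2, either preserves or
   reverses the height (x,y) |-> b(x), because the upper and the lower neighbours
   of a vertex are told apart by counting common neighbours; hence it acts on the
   two trees, possibly exchanging them.  Let l > 0 generate the group of height
   translations, so that the height-reversing elements act on heights by
   h |-> c - h with c constant modulo l.  For s >= 0 consider
     Y = {(x,y) : b(x) = -s mod l, b(x) + b'(y) = -(s + s')},  s' = s + c,
   which is a copy of DL(m^l,n^l), and which the height-reversing elements
   preserve thanks to the choice of s'.  Its points are the pairs (s-th ancestor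
   of x, s'-th ancestor of y) with (x,y) a vertex of height 0 mod l.  The
   height-preserving elements and the translations by multiples of l have finitely
   many orbits on these vertices (x,y), with representatives of height 0; for s
   large all representatives yield the same point of Y, so the action on Y is
   transitive. *)

Require Import Defs.
From HB Require Import structures.
From mathcomp Require Import all_boot all_order all_algebra.
From mathcomp Require Import boolp classical_sets functions cardinality.
From mathcomp Require Import filter topology.
From mathcomp Require Import perm zify.

Set Implicit Arguments.
Unset Strict Implicit.
Unset Printing Implicit Defensive.

Import Order.TTheory GRing.Theory Num.Theory.

Local Open Scope classical_set_scope.

(** * Parents and Busemann function in a tree with an end *)

Section AvoidingPaths.
Variable X : graph.
Implicit Types x a b c : X.

(** Membership in the same component after deletion of [x]. *)
Definition avoid x a b := exists p, [/\ path adj a p, last a p = b & x \notin a :: p].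

Lemma avoid_refl x a : a <> x -> avoid x a a.
Proof. by move=> ax; exists [::]; split=> //; rewrite inE; apply/eqP => /esym. Qed.

Lemma avoid_step x a b : a <> x -> b <> x -> adj a b -> avoid x a b.
Proof.
move=> ax bx ab; exists [:: b]; split=> //=; first by rewrite ab.
by rewrite !inE negb_or; apply/andP; split; apply/eqP => /esym.
Qed.

Lemma avoid_trans x a b c : avoid x a b -> avoid x b c -> avoid x a c.
Proof.
move=> [p [ap <- xp]] [r [br <- xr]]; exists (p ++ r); split.
- by rewrite cat_path ap.
- by rewrite last_cat.
- by move: xp xr; rewrite !inE mem_cat !negb_or => /andP[-> ->] /andP[_ ->].
Qed.

Lemma avoid_sym x a b : avoid x a b -> avoid x b a.
Proof.
move=> [p]; elim: p a => [|c p IH] a [].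
  by move=> _ /= <- xa; exists [::].
move=> /= /andP[ac cp] cb; rewrite inE negb_or => /andP[/eqP xa xp].
apply: (@avoid_trans _ _ c); first by apply: IH; split.
apply: avoid_step; last by rewrite adj_sym.
- by move=> cx; move: xp; rewrite cx mem_head.
- by move=> ax; apply: xa.
Qed.

(** A shortened path from [a] to [b] missing [x] closes up through [x] to a simple cycle. Its size
    is at most 2 only if the path is trivial. *)
Lemma acyclic_avoid x a b :
  acyclic_graph X -> adj x a -> adj x b -> avoid x a b -> a = b.
Proof.
move=> acX xa xb [p [ap pb xp]]; move: pb.
case: (shortenP ap) => p' ap' up' sp' p'b.
have /acX : ucycle adj (x :: a :: p').
  rewrite /ucycle /= xa rcons_path ap' p'b adj_sym xb /=.
  move: up' => /= ->; rewrite andbT.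
  apply: contra xp; rewrite !inE => /orP[->//|/sp' ->]; exact: orbT.
by case: p' p'b {ap' up' sp'}.
Qed.

End AvoidingPaths.

Section Parents.
Variables (q : nat) (T : ended_tree q).
Implicit Types (x y z : T) (r s : nat -> T).

Lemma cofinal_sym r s : cofinal r s -> cofinal s r.
Proof. by move=> [i [j rs]]; exists j, i => k. Qed.

Lemma cofinal_trans r s t : cofinal r s -> cofinal s t -> cofinal r t.
Proof.
move=> [i [j rs]] [i' [j' st]]; exists (i + i')%N, (j' + j)%N => k.
by rewrite -!addnA rs -st addnCA.
Qed.

Lemma end_ray r : minus_infty T r -> ray r.
Proof. by have [r0 _ ->] := minus_infty_end T; case. Qed.

Lemma end_cofinal r s : minus_infty T r -> minus_infty T s -> cofinal r s.
Proof.
have [r0 _ ->] := minus_infty_end T; move=> [_ rr] [_ rs].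
exact: cofinal_trans (cofinal_sym rr) rs.
Qed.

Lemma end_of_cofinal r s : minus_infty T r -> ray s -> cofinal r s -> minus_infty T s.
Proof.
have [r0 _ ->] := minus_infty_end T; move=> [_ rr] rs ?; split=> //.
exact: cofinal_trans rr _.
Qed.

Lemma ray_shift x r i : ray_to_end x r -> ray_to_end (r i) (fun k => r (i + k)%N).
Proof.
move=> [Er r0]; split; last by rewrite addn0.
have [ri ra] := end_ray Er; apply: (end_of_cofinal Er); last by exists i, 0%N.
by split=> [j k /ri/addnI//|j]; rewrite addnS.
Qed.

Lemma ray_cons x y r : ray_to_end x r -> adj y x -> (forall i, r i <> y) ->
  ray_to_end y (fun i => if i is j.+1 then r j else y).
Proof.
move=> [Er r0] yx ry; split=> //; have [ri ra] := end_ray Er.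
apply: (end_of_cofinal Er); last by exists 0%N, 1%N => k.
split=> [[|i] [|j] //|[|i]]; last exact: ra.
- by move/esym/ry.
- by move/ry.
- by move/ri ->.
- by rewrite r0.
Qed.

(** Induction along a path to [x] from the origin of a ray defining the end: at each edge, the
    current ray is cut at the new vertex if it visits it, and otherwise prolonged backwards by
    it. *)
Lemma ray_exists x : exists r, ray_to_end x r.
Proof.
have [r0 rr0 E0] := minus_infty_end T.
have [p pp <-] := (et_tree T).1 (r0 0%N) x.
have: exists r, ray_to_end (r0 0%N) r.
  by exists r0; split=> //; rewrite E0; split=> //; exists 0%N, 0%N.
elim: p (r0 0%N) pp => //= z p IH y /andP[yz zp] [r ryr]; apply: IH zp _.
case: (pselect (exists i, r i = z)) => [[i <-]|nz].
  by eexists; exact: ray_shift ryr.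
eexists; apply: (ray_cons ryr); first by rewrite adj_sym.
by move=> i ri; apply: nz; exists i.
Qed.

Lemma ray_avoid x r i : ray_to_end x r -> avoid x (r 1%N) (r i.+1).
Proof.
move=> [/end_ray[ri ra] r0].
have rx k : r k.+1 <> x by rewrite -r0 => /ri.
elim: i => [|i IH]; first exact: avoid_refl.
by apply: avoid_trans IH _; apply: avoid_step.
Qed.

(** The two rays eventually merge, so their second vertices are joined by a path avoiding [x];
    acyclicity makes these two neighbours of [x] equal. *)
Lemma ray_next x r s : ray_to_end x r -> ray_to_end x s -> r 1%N = s 1%N.
Proof.
move=> xr xs; have [i [j rs]] := end_cofinal xr.1 xs.1.
apply: (@acyclic_avoid _ x); first exact: (et_tree T).2.
- by rewrite -xr.2; apply: (end_ray xr.1).2.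
- by rewrite -xs.2; apply: (end_ray xs.1).2.
apply: avoid_trans (ray_avoid i xr) _.
by rewrite -addn1 rs addn1; apply/avoid_sym/ray_avoid.
Qed.

Definition parent x : T := xget x [set y | exists2 r, ray_to_end x r & r 1%N = y].

Lemma parentE x r : ray_to_end x r -> parent x = r 1%N.
Proof.
move=> xr; rewrite /parent; case: xgetP => [y _ [s xs <-]|/(_ (r 1%N))[]].
  exact: ray_next xs xr.
by exists r.
Qed.

Lemma rayE x r : ray_to_end x r -> r = (fun i => iter i parent x).
Proof.
move=> xr; apply/funext; elim=> [|i IH]; first exact: xr.2.
by rewrite iterS -IH (parentE (ray_shift i xr)) addn1.
Qed.

Lemma parent_ray x : ray_to_end x (fun i => iter i parent x).
Proof. by have [r xr] := ray_exists x; rewrite -(rayE xr). Qed.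

Lemma iter_parent_inj x : injective (fun i => iter i parent x).
Proof. exact: (end_ray (parent_ray x).1).1. Qed.

Lemma parent_adj x : adj x (parent x).
Proof. exact: ((end_ray (parent_ray x).1).2 0%N). Qed.

Lemma parent_join x y : exists i j, iter i parent x = iter j parent y.
Proof.
have [i [j /(_ 0%N)]] := end_cofinal (parent_ray x).1 (parent_ray y).1.
by rewrite !addn0 => e; exists i, j.
Qed.

Lemma adj_parent x y : adj x y <-> parent x = y \/ parent y = x.
Proof.
split=> [xy|[<-|<-]]; [|exact: parent_adj|by rewrite adj_sym parent_adj].
case: (pselect (parent x = y)) => [|pxy]; [by left | right].
have yx : adj y x by rewrite adj_sym.
(* Prolonging the ray of [x] by [y] gives the ray of [y]. If [y] lay on the ray of [x], it would be
   joined to [parent x] away from [x], and so equal it. *)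
apply: (parentE (ray_cons (parent_ray x) yx _)) => -[/= xy'|i iy].
  by move: xy; rewrite xy' adj_irr.
apply: pxy; apply: (@acyclic_avoid _ x) => //; first exact: (et_tree T).2.
  exact: parent_adj.
by rewrite -iy; exact: (ray_avoid i (parent_ray x)).
Qed.

Lemma parent_join_eq x y i j i' j' :
  iter i parent x = iter j parent y -> iter i' parent x = iter j' parent y ->
  (i + j')%N = (i' + j)%N.
Proof.
move=> e e'; apply: (@iter_parent_inj y); rewrite /= !iterD -e -e' -!iterD.
by rewrite addnC.
Qed.

(** Counted through any common vertex of the two rays, not only the first one; [parent_join_eq]
    gives independence of that vertex, and [busemannE] identifies this with the Busemann
    function. *)
Definition height x : int :=
  xget 0%R [set k | exists i j,
    iter i parent x = iter j parent (base T) /\ k = (i%:Z - j%:Z)%R].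

Lemma heightE x i j :
  iter i parent x = iter j parent (base T) -> height x = (i%:Z - j%:Z)%R.
Proof.
move=> e; rewrite /height; case: xgetP => [_ _ [i' [j' [e' ->]]]|].
  by have := parent_join_eq e e'; lia.
by move/(_ (i%:Z - j%:Z)%R) => []; exists i, j.
Qed.

Lemma height_parent x : height (parent x) = (height x - 1)%R.
Proof.
have [i [j e]] := parent_join x (base T).
rewrite (heightE e) (@heightE _ i j.+1); first lia.
by rewrite -iterSr !iterS e.
Qed.

Lemma height_path x p : path adj x p -> (height x - height (last x p) <= size p)%R.
Proof.
elim: p x => [|y p IH] x /=; first by rewrite subrr.
move=> /andP[/adj_parent xy /IH].
have : (height x <= height y + 1)%R.
  by case: xy => <-; rewrite height_parent; lia.
lia.
Qed.

Lemma joined_iter x i : joined_in x (iter i parent x) i.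
Proof.
elim: i x => [|i IH] x; first by exists [::].
have [p [pp lp sp]] := IH (parent x).
exists (parent x :: p); split; rewrite /= ?parent_adj ?sp //.
by rewrite -iterS iterSr.
Qed.

(** Height drops by at most 1 along an edge, so no path is shorter than the one through the
    successive parents. *)
Lemma dist_iter x i : dist x (iter i parent x) = i.
Proof.
have hi : height (iter i parent x) = (height x - i%:Z)%R.
  by elim: i => [|i IH]; rewrite ?subr0 // iterS height_parent IH; lia.
have low l : joined_in x (iter i parent x) l -> (i <= l)%N.
  by move=> [p [/height_path + lp <-]]; rewrite lp hi; lia.
rewrite /dist; case: xgetP => [k _ [/low ik /(_ i (joined_iter x i))]|]; first lia.
by move/(_ i) => []; split=> //; exact: joined_iter.
Qed.

Lemma merge_exists x y : exists z, is_merge x y z.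
Proof.
pose P i := `[< exists j, iter i parent x = iter j parent y >].
have exP : exists i, P i.
  by have [i [j e]] := parent_join x y; exists i; apply/asboolP; exists j.
case: (ex_minnP exP) => i /asboolP[j e] imin.
exists (iter i parent x), (fun k => iter k parent x), (fun k => iter k parent y).
split; [exact: parent_ray..|].
exists i, j; split=> // i' j' e'; have ii' : (i <= i')%N.
  by apply: imin; apply/asboolP; exists j'.
by split=> //; have := parent_join_eq e e'; lia.
Qed.

Lemma busemannE x : busemann x = height x.
Proof.
have [z0 hz0] := merge_exists x (base T).
have : is_merge x (base T) (Defs.merge x (base T)) by apply: xgetPex; exists z0.
rewrite /busemann; move: (Defs.merge _ _) => z [r [s [xr xs]]].
rewrite (rayE xr) (rayE xs) => -[i [j [ez ez' _]]].
rewrite -[in dist x z]ez -ez' !dist_iter; apply/esym/heightE.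
by rewrite ez ez'.
Qed.

Lemma busemann_base : busemann (base T) = 0%R.
Proof. by rewrite busemannE (@heightE _ 0%N 0%N). Qed.

Lemma busemann_parent x : busemann (parent x) = (busemann x - 1)%R.
Proof. by rewrite !busemannE height_parent. Qed.

Lemma parent2_neq x : parent (parent x) <> x.
Proof. by move=> /(congr1 height); rewrite !height_parent; lia. Qed.

Lemma parent_label : exists c : T -> 'I_q,
  (forall x y, parent x = parent y -> c x = c y -> x = y) /\
  (forall x a, exists y, parent y = x /\ c y = a).
Proof.
have children x : exists f : 'I_q -> T, injective f /\
    (forall y, parent y = x <-> exists a, f a = y).
  have /card_set_bijP[f [fN finj fsurj]] := et_regular x.
  have fq y : adj x y -> (f y < q.+1)%N by move=> /fN.
  pose k0 := Ordinal (fq _ (parent_adj x)).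
  (* Regularity numbers the neighbours of [x] from 0 to q; [lift k0] skips the number of the parent
     and leaves q numbers for the children. *)
  have /choice[g gP] : forall a, exists y, adj x y /\ f y = lift k0 a.
    by move=> a; have [y xy fy] := fsurj _ (ltn_ord (lift k0 a)); exists y.
  have nonpar a : g a <> parent x.
    move=> e; have := (gP a).2; rewrite e => k0a.
    by move/eqP: (neq_lift k0 a); apply; apply: val_inj.
  exists g; split=> [a b ab|y].
    apply: (@lift_inj _ k0); apply: val_inj.
    by have := (gP a).2; rewrite ab (gP b).2.
  split=> [yx|[a <-]]; last first.
    by have [/adj_parent[/esym/nonpar|] //] := gP a.
  have xy : adj x y by apply/adj_parent; right.
  case: (unliftP k0 (Ordinal (fq y xy))) => [a ya|/(congr1 val) /= fy].
    exists a; apply: finj; rewrite ?inE //=; first exact: (gP a).1.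
    by rewrite (gP a).2 -ya.
  have e : y = parent x by apply: finj; rewrite ?inE //=; exact: parent_adj.
  by have := @parent2_neq x; rewrite -e yx.
have [ch chP] := choice children.
have /choice[c cP] : forall y, exists a, ch (parent y) a = y.
  by move=> y; apply/(chP (parent y)).2.
exists c; split=> [x y e ce|x a]; first by rewrite -(cP x) -(cP y) e ce.
exists (ch x a); have e : parent (ch x a) = x by apply/(chP x).2; exists a.
by split=> //; apply: (chP x).1; rewrite -{1}e cP.
Qed.

End Parents.

(** * Horocyclic trees *)

(** A tree with a fixed end, reduced to its parent map and its levels. The labels are an arbitrary
    numbering of the q children of each vertex, which group actions need not respect. *)
Record horotree (q : nat) := Horotree {
  vert :> Type;
  par : vert -> vert;
  lev : vert -> int;
  label : vert -> 'I_q;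
  origin : vert;
  lev_par : forall x, lev (par x) = (lev x - 1)%R;
  lev_origin : lev origin = 0%R;
  label_inj : forall x y, par x = par y -> label x = label y -> x = y;
  label_surj : forall x a, exists y, par y = x /\ label y = a;
  par_join : forall x y, exists i j, iter i par x = iter j par y
}.

Arguments par {q h}.
Arguments lev {q h}.
Arguments label {q h}.

Section HorotreeTheory.
Variables (q : nat) (H : horotree q).
Implicit Types x y : H.

Lemma lev_iter i x : lev (iter i par x) = (lev x - i%:Z)%R.
Proof. by elim: i => [|i IH]; rewrite ?subr0 // iterS lev_par IH; lia. Qed.

Lemma descendant i x : exists y, iter i par y = x.
Proof.
elim: i => [|i [y <-]]; first by exists x.
by have [z [<- _]] := label_surj y (label y); exists z; rewrite iterSr.
Qed.

Lemma lev_surj k : exists x, lev x = k.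
Proof.
have lr := lev_origin H.
have [k0|k0] := leP k 0%R.
  by exists (iter `|k| par (origin H)); rewrite lev_iter lr; lia.
have [x /(congr1 lev)] := descendant `|k| (origin H).
by rewrite lev_iter lr => e; exists x; lia.
Qed.

Lemma par_join_lev x y : lev x = lev y -> exists k, iter k par x = iter k par y.
Proof.
move=> xy; have [i [j e]] := par_join x y; exists i.
have := congr1 lev e; rewrite !lev_iter xy => ij.
have ji : j = i by lia.
by rewrite e ji.
Qed.

(* Relabelling makes the ray from the origin constant, so that trees with the
   same number of labels can be matched along this ray. *)
Lemma normal_label a0 : exists c : H -> 'I_q,
  [/\ forall x y, par x = par y -> c x = c y -> x = y,
      forall x a, exists y, par y = x /\ c y = a &
      forall i, c (iter i par (origin H)) = a0].
Proof.
(* On each level at most 0, the label of the ancestor of the origin is exchanged with [a0]. The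
   permutation depends on the level only, so siblings are still numbered bijectively. *)
pose s (k : int) := if (k <= 0)%R then tperm (label (iter `|k| par (origin H))) a0 else 1%g.
exists (fun x => s (lev x) (label x)); split=> [x y e|x a|i].
- have /(congr1 (+%R^~ 1%R)) := congr1 lev e; rewrite !lev_par !subrK => <-.
  by move=> /perm_inj; exact: label_inj.
- have [y [<- ya]] := label_surj x ((s (lev x + 1)%R)^-1%g a); exists y; split=> //.
  by move: ya; rewrite lev_par subrK => ->; rewrite permKV.
- rewrite lev_iter lev_origin /s ifT; last lia.
  have -> : `|(0 - i%:Z)%R|%N = i by lia.
  by rewrite tpermL.
Qed.

End HorotreeTheory.

(** * Uniqueness of the horocyclic tree with q children at each vertex *)

Section Isomorphism.
Variable q : nat.

(* A vertex is determined by its level and by the labels along its ray to the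
   end; these labels are eventually those of the ray from the origin. *)
Definition same_code (H H' : horotree q) (c : H -> 'I_q) (c' : H' -> 'I_q) x x' :=
  lev x = lev x' /\ forall i, c (iter i par x) = c' (iter i par x').

(** Induction on the number of steps from [x] up to the ray of the origin: on that ray both codes
    are constantly [a0], and below it a child with the required label exists. *)
Lemma same_code_total (H H' : horotree q) (c : H -> 'I_q) (c' : H' -> 'I_q) a0 :
  (forall x a, exists y, par y = x /\ c' y = a) ->
  (forall i, c (iter i par (origin H)) = a0) ->
  (forall i, c' (iter i par (origin H')) = a0) ->
  forall x, exists x', same_code c c' x x'.
Proof.
move=> surj cr cr' x; have [i [j]] := par_join x (origin H).
elim: i x => [|i IH] x /= e.
  exists (iter j par (origin H')); split=> [|i].
    by rewrite e !lev_iter (lev_origin H) (lev_origin H').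
  by rewrite e -!iterD cr cr'.
have [|x' [lx cx]] := IH (par x); first by rewrite -iterSr.
have [y' [yx yc]] := surj x' (c x); exists y'; split=> [|[|k] //].
  by have := lev_par y'; rewrite yx -lx lev_par => /(congr1 (+%R^~ 1%R)); rewrite !subrK.
by rewrite (iterSr k par x) (iterSr k par y') yx cx.
Qed.

(** Vertices of equal level have a common ancestor the same number of steps above them; equal labels
    then force equality at each step back down. *)
Lemma same_code_inj (H H' : horotree q) (c : H -> 'I_q) (c' : H' -> 'I_q) :
  (forall x y, par x = par y -> c x = c y -> x = y) ->
  forall x y x', same_code c c' x x' -> same_code c c' y x' -> x = y.
Proof.
move=> inj x y x' [lx cx] [ly cy].
have [k] := par_join_lev (etrans lx (esym ly)).
have {cx cy} cxy i : c (iter i par x) = c (iter i par y) by rewrite cx cy.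
elim: k => // k IH e; apply: IH; exact: inj e (cxy k).
Qed.

Lemma horotree_iso (H H' : horotree q) : exists f : H -> H',
  [/\ injective f, forall x', exists x, f x = x',
      forall x, f (par x) = par (f x) & forall x, lev (f x) = lev x].
Proof.
pose a0 := label (origin H).
have [c [ci cs cr]] := normal_label H a0; have [c' [ci' cs' cr']] := normal_label H' a0.
have sym x x' : same_code c c' x x' <-> same_code c' c x' x.
  by split=> -[e1 e2]; split=> [|i]; rewrite ?e1 ?e2.
have [f fP] := choice (same_code_total cs' cr cr').
have fE x x' : same_code c c' x x' -> f x = x'.
  by move=> /sym xx'; apply: (same_code_inj ci' _ xx'); apply/sym.
exists f; split=> [x y xy|x'|x|x].
- by apply: (same_code_inj ci (fP x)); rewrite xy.
- have [x /sym xx'] := same_code_total cs cr' cr x'; exists x; exact: fE.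
- apply: fE; have [lx cx] := fP x; split=> [|i]; first by rewrite !lev_par lx.
  by rewrite -!iterSr.
- by have [] := fP x.
Qed.

End Isomorphism.

(** * The tree formed by every l-th level *)

Section Skeleton.
Variables (q : nat) (H : horotree q) (l : nat) (l_gt0 : (0 < l)%N) (k : int).

Definition in_skeleton (x : H) := (l %| (lev x - k)%R)%Z.

Definition skeleton_vert := {x : H | in_skeleton x}.

Lemma iter_in_skeleton (x : H) : in_skeleton x -> in_skeleton (iter l par x).
Proof.
rewrite /in_skeleton lev_iter addrAC => xl.
by rewrite rpredB // dvdzz.
Qed.

Definition skeleton_par (x : skeleton_vert) : skeleton_vert :=
  exist _ (iter l par (val x)) (iter_in_skeleton (valP x)).

(** The labels of the last l steps down to [x]. They tell apart the q^l vertices with the same l-th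
    ancestor, and so number the children in the skeleton. *)
Definition word (x : H) : {ffun 'I_l -> 'I_q} := [ffun i : 'I_l => label (iter i par x)].

Lemma card_word : #|{ffun 'I_l -> 'I_q}| = (q ^ l)%N.
Proof. by rewrite card_ffun !card_ord. Qed.

Definition skeleton_label (x : skeleton_vert) : 'I_(q ^ l) :=
  cast_ord card_word (enum_rank (word (val x))).

Definition skeleton_lev (x : skeleton_vert) : int := ((lev (val x) - k)%R %/ l)%Z.

Lemma skeleton_levE x : (lev (val x) = k + skeleton_lev x * l%:Z)%R.
Proof.
have /divzK e : (l %| (lev (val x) - k)%R)%Z := valP x.
by rewrite /skeleton_lev e addrC subrK.
Qed.

Lemma val_inj_skeleton (x y : skeleton_vert) : val x = val y -> x = y.
Proof. by case: x y => [x hx] [y hy] /= e; subst y; congr exist; exact: bool_irrelevance. Qed.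

Lemma skeleton_lev_par x : skeleton_lev (skeleton_par x) = (skeleton_lev x - 1)%R.
Proof.
have := skeleton_levE (skeleton_par x); rewrite /= lev_iter skeleton_levE.
move: (skeleton_lev _) (skeleton_lev _) => a b e.
have : ((b - 1 - a) * l%:Z = 0)%R by lia.
by move/eqP; rewrite mulf_eq0; case/orP => /eqP; lia.
Qed.

Lemma word_inj n (x y : H) : iter n par x = iter n par y ->
  (forall i, (i < n)%N -> label (iter i par x) = label (iter i par y)) -> x = y.
Proof.
elim: n => // n IH e xy; apply: IH => [|i /ltnW/xy//].
by apply: label_inj; [exact: e | exact: xy].
Qed.

Lemma word_surj n (x : H) (a : nat -> 'I_q) : exists y, iter n par y = x /\
  forall i, (i < n)%N -> label (iter i par y) = a i.
Proof.
elim: n a => [|n IH] a; first by exists x.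
have [z [zx za]] := IH (a \o S); have [y [yz ya]] := label_surj z (a 0%N).
exists y; split=> [|[|i] // i_n]; first by rewrite iterSr yz.
by rewrite iterSr yz; exact: za.
Qed.

Lemma skeleton_label_inj x y : skeleton_par x = skeleton_par y ->
  skeleton_label x = skeleton_label y -> x = y.
Proof.
move=> /(congr1 val) /= e /cast_ord_inj /enum_rank_inj xy.
apply: val_inj_skeleton; apply: (word_inj e) => i il.
by have /ffunP/(_ (Ordinal il)) := xy; rewrite !ffunE.
Qed.

Lemma skeleton_label_surj x a : exists y, skeleton_par y = x /\ skeleton_label y = a.
Proof.
pose w : {ffun 'I_l -> 'I_q} := enum_val (cast_ord (esym card_word) a).
have [y [yx yw]] := word_surj l (val x) (fun i => w (insubd (Ordinal l_gt0) i)).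
have yin : in_skeleton y.
  have := valP x; rewrite -yx /in_skeleton lev_iter => xl.
  have -> : (lev y - k = lev y - l%:Z - k + l%:Z)%R by lia.
  by rewrite rpredD // dvdzz.
exists (exist _ y yin); split; first exact: val_inj_skeleton.
rewrite /skeleton_label /=; have -> : word y = w.
  apply/ffunP => i; rewrite ffunE yw ?ltn_ord //; congr (w _).
  by apply: val_inj; rewrite /= val_insubd ltn_ord.
by rewrite /w enum_valK cast_ordKV.
Qed.

Lemma val_iter_skeleton i x : val (iter i skeleton_par x) = iter (i * l) par (val x).
Proof. by elim: i => //= i ->; rewrite -iterD. Qed.

Lemma skeleton_join x y : exists i j, iter i skeleton_par x = iter j skeleton_par y.
Proof.
have [i [j e]] := par_join (val x) (val y).
(* The common ancestor is moved up so that its distance from [x] is a multiple of l; since both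
   levels are congruent to k modulo l, its distance from [y] is one too. *)
have e1 : iter (i * l) par (val x) = iter (i * l - i + j) par (val y).
  have il : (i <= i * l)%N by rewrite leq_pmulr.
  by rewrite -[in LHS](subnK il) !iterD e.
have := congr1 lev e1; rewrite !lev_iter !skeleton_levE.
move: (i * l - i + j)%N e1 => r e1 er.
have [t tE] : exists t : nat, r = (t * l)%N.
  exists (r %/ l)%N; rewrite divnK //.
  have -> : (l %| r) = (l %| r%:Z)%Z by [].
  have -> : (r%:Z = (skeleton_lev y - skeleton_lev x + i%:Z) * l%:Z)%R by lia.
  exact: dvdz_mull.
by exists i, t; apply: val_inj_skeleton; rewrite !val_iter_skeleton -tE.
Qed.

Lemma skeleton_origin : exists x, skeleton_lev x = 0%R.
Proof.
have [x xk] := lev_surj H k.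
have xin : in_skeleton x by rewrite /in_skeleton xk subrr dvdz0.
by exists (exist _ x xin); rewrite /skeleton_lev /= xk subrr div0z.
Qed.

Definition skeleton : horotree (q ^ l) :=
  let r := cid skeleton_origin in
  Horotree skeleton_lev_par (projT2 r) skeleton_label_inj skeleton_label_surj
    skeleton_join.

End Skeleton.

(** Any tree with branching q^l is isomorphic to the skeleton, hence is realised inside [H] on the
    levels congruent to k modulo l, one generation becoming l generations. *)
Lemma skeleton_embedding q (H : horotree q) l (H' : horotree (q ^ l)) (k : int) :
  (0 < l)%N ->
  exists f : H' -> H,
    [/\ injective f, forall x, (l %| (lev x - k)%R)%Z -> exists x', f x' = x,
        forall x', f (par x') = iter l par (f x') &
        forall x', lev (f x') = (k + lev x' * l%:Z)%R].
Proof.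
move=> l_gt0; have [f [fi fs fp fl]] := horotree_iso H' (skeleton H l_gt0 k).
exists (fun x' => val (f x')); split=> [x y /val_inj_skeleton/fi//|x xl|x'|x'].
- by have [x' e] := fs (exist _ x xl); exists x'; rewrite e.
- by rewrite fp.
- by rewrite skeleton_levE -[skeleton_lev _]/(lev (f x')) fl.
Qed.

Definition horotree_of q (T : ended_tree q) : horotree q :=
  let c := cid (parent_label T) in
  Horotree (@busemann_parent q T) (busemann_base T) (projT2 c).1 (projT2 c).2
    (@parent_join q T).

(** * Automorphisms of horocyclic products *)

(** The points form an abstract type with two coordinate maps, so that [swap] exchanges the trees
    while keeping the points; statements on one tree then transfer to the other. *)
Record horoproduct (m n : nat) (X : Type) := Horoproduct {
  left_tree : horotree m;
  right_tree : horotree n;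
  left : X -> left_tree;
  right : X -> right_tree;
  lev_right : forall u, lev (right u) = (- lev (left u))%R;
  point_eq : forall u v, left u = left v -> right u = right v -> u = v;
  point_ex : forall x y, (lev x + lev y = 0)%R -> exists u, left u = x /\ right u = y
}.

Arguments left {m n X h}.
Arguments right {m n X h}.

Section Swap.
Variables (m n : nat) (X : Type) (D : horoproduct m n X).

Let swap_lev (u : X) : lev (@left _ _ _ D u) = (- lev (@right _ _ _ D u))%R.
Proof. by rewrite lev_right opprK. Qed.

Let swap_ex x y : (lev x + lev y = 0)%R ->
  exists u, @right _ _ _ D u = x /\ @left _ _ _ D u = y.
Proof. by rewrite addrC => /point_ex[u [ux uy]]; exists u. Qed.

Definition swap : horoproduct n m X :=
  Horoproduct swap_lev (fun u v e e' => point_eq e' e) swap_ex.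

End Swap.

(** * Recovering the two trees from the oriented edges *)

Section Chains.
Variables (X : Type) (R : X -> X -> Prop).

Fixpoint chain k u v :=
  if k is k'.+1 then exists2 w, R u w & chain k' w v else u = v.

(** Expressed by the relation alone, hence preserved by every map preserving it. For [up] it detects
    coinciding ancestors in the left tree, which is how orientation-preserving automorphisms act on
    that tree. *)
Definition meet i j u v := exists u' v' k w,
  [/\ chain i u' u, chain j v' v, chain k u' w & chain k v' w].

End Chains.

Lemma chain_map X Y (R : X -> X -> Prop) (R' : Y -> Y -> Prop) (f : X -> Y) :
  (forall u v, R u v -> R' (f u) (f v)) ->
  forall k u v, chain R k u v -> chain R' k (f u) (f v).
Proof.
move=> fR; elim=> [|k IH] u v /=; first by move=> ->.
by move=> [w /fR uw /IH wv]; exists (f w).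
Qed.

Lemma meet_map X Y (R : X -> X -> Prop) (R' : Y -> Y -> Prop) (f : X -> Y) :
  (forall u v, R u v -> R' (f u) (f v)) ->
  forall i j u v, meet R i j u v -> meet R' i j (f u) (f v).
Proof.
move=> fR i j u v [u' [v' [k [w [? ? ? ?]]]]].
by exists (f u'), (f v'), k, (f w); split; apply: chain_map fR _ _ _ _.
Qed.

Section Up.
Variables (m n : nat) (X : Type) (D : horoproduct m n X).
Implicit Types u v w : X.
Notation p1 := (@left _ _ _ D).
Notation p2 := (@right _ _ _ D).

Definition up u v := par (p1 v) = p1 u /\ par (p2 u) = p2 v.

Definition lev_left u : int := lev (p1 u).

Lemma lev_up u v : up u v -> lev_left v = (lev_left u + 1)%R.
Proof. by rewrite /lev_left => -[<- _]; rewrite lev_par subrK. Qed.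

Lemma up_asym u v : up u v -> ~ up v u.
Proof. by move=> /lev_up e /lev_up; lia. Qed.

Lemma chain_upP k u v :
  chain up k u v <-> iter k par (p1 v) = p1 u /\ iter k par (p2 u) = p2 v.
Proof.
elim: k u => [|k IH] u /=.
  by split=> [->|[e1 e2]] //; apply: (@point_eq _ _ _ D).
split=> [[w [w1 w2] /IH[e1 e2]]|[e1 e2]].
  by rewrite e1 w1 -e2 -w2 -iterSr.
have [|w [w1 w2]] := @point_ex _ _ _ D (iter k par (p1 v)) (par (p2 u)).
  by have := congr1 lev e1; rewrite !lev_par lev_right; lia.
exists w; first by split; rewrite ?w1.
by apply/IH; rewrite w1 w2 -iterSr.
Qed.

(** Going down i steps from [u] and j steps from [v] reaches points with the same left coordinate.
    Their right coordinates have equal level, so some k-th ancestors agree, and both points can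
    climb k steps to a common point. *)
Lemma meet_upP i j u v :
  meet up i j u v <-> iter i par (p1 u) = iter j par (p1 v).
Proof.
split=> [[u' [v' [k [w [/chain_upP[-> _] /chain_upP[-> _]]]]]]|e].
  by move=> /chain_upP[<- _] /chain_upP[<- _].
have above l z : exists z', p1 z' = iter l par (p1 z) /\ chain up l z' z.
  have [y yz] := descendant l (p2 z).
  have [|z' [z1 z2]] := @point_ex _ _ _ D (iter l par (p1 z)) y.
    by have := congr1 lev yz; rewrite !lev_iter lev_right; lia.
  by exists z'; split=> //; apply/chain_upP; rewrite z1 z2.
have [u' [u1 uu']] := above i u; have [v' [v1 vv']] := above j v.
have [|k ek] := @par_join_lev _ _ (p2 u') (p2 v').
  by rewrite !lev_right u1 v1 e.
have [x xk] := descendant k (p1 u').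
have [|w [w1 w2]] := @point_ex _ _ _ D x (iter k par (p2 u')).
  by have := congr1 lev xk; rewrite !lev_iter lev_right; lia.
exists u', v', k, w; split=> //; apply/chain_upP; rewrite w1 w2; split=> //.
by rewrite xk u1 v1.
Qed.

(** Connectedness as an invariance principle: some ancestors of the left coordinates agree, so
    [meet_upP] joins any two points by four chains. *)
Lemma up_connected (P : X -> Prop) : (forall u v, up u v -> (P u <-> P v)) ->
  forall u v, P u -> P v.
Proof.
move=> upP u v; have [i [j e]] := par_join (p1 u) (p1 v).
have chP k a b : chain up k a b -> (P a <-> P b).
  elim: k a => [|k IH] a /= => [->//|[w /upP aw /IH wb]]; exact: iff_trans aw wb.
have /meet_upP[u' [v' [k [w [/chP h1 /chP h2 /chP h3 /chP h4]]]]] := e.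
by move=> /h1 /h3 /h4 /h2.
Qed.

Lemma up_exists u : exists v, up u v.
Proof.
have [x xu] := descendant 1 (p1 u).
have [|v [v1 v2]] := @point_ex _ _ _ D x (par (p2 u)).
  by have := congr1 lev xu; rewrite /= !lev_par lev_right; lia.
by exists v; rewrite /up v1 v2.
Qed.

Definition neighbour u v := up u v \/ up v u.

(* The first half of the local criterion telling apart the two directions: two
   upper neighbours of a point have a second common neighbour, whereas an upper
   and a lower neighbour have no other. *)
Lemma common_neighbour u v v' : (1 < n)%N -> up u v -> up u v' ->
  exists u', [/\ u' <> u, neighbour u' v & neighbour u' v'].
Proof.
move=> n_gt1 [uv1 uv2] [uv1' uv2'].
have [a la] : exists a, a != label (p2 u).
  exists (if label (p2 u) == Ordinal (ltnW n_gt1) then Ordinal n_gt1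
          else Ordinal (ltnW n_gt1)).
  by case: (eqVneq (label _) _) => [->|]; rewrite // eq_sym.
have [y [yu ya]] := label_surj (par (p2 u)) a.
have [|u' [u1 u2]] := @point_ex _ _ _ D (p1 u) y.
  by have := congr1 lev yu; rewrite !lev_par lev_right; lia.
exists u'; split; [|by left; split; rewrite ?u1 ?u2 ?yu..].
by move=> u'u; move: la; rewrite -ya -u2 u'u eqxx.
Qed.

(** Levels force [w] to lie between [v'] and [v]; its left coordinate is then the parent of that of
    [v], its right coordinate the parent of that of [v']. *)
Lemma unique_common_neighbour u v v' w : up u v -> up v' u ->
  neighbour w v -> neighbour w v' -> w = u.
Proof.
move=> uv v'u wv wv'.
have {wv}wv : up w v.
  by case: wv wv' (lev_up uv) (lev_up v'u) => // /lev_up + [] /lev_up; lia.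
have {wv'}v'w : up v' w.
  by case: wv' (lev_up uv) (lev_up v'u) (lev_up wv) => // /lev_up; lia.
by apply: (@point_eq _ _ _ D); rewrite -?wv.1 -?uv.1 -?v'w.2 -?v'u.2.
Qed.

End Up.

Lemma up_swap m n X (D : horoproduct m n X) u v : up (swap D) u v <-> up D v u.
Proof. by rewrite /up /=; split=> -[]. Qed.

Lemma neighbour_swap m n X (D : horoproduct m n X) u v :
  neighbour (swap D) u v <-> neighbour D u v.
Proof. by rewrite /neighbour !up_swap; split=> -[]; [right|left|right|left]. Qed.

Section Automorphism.
Variables (X : Type) (f f' : X -> X).
Hypothesis fK : cancel f f'.
Hypothesis f'K : cancel f' f.

(** Otherwise the second common neighbour of [v] and [v'] would also be mapped to [f u], against
    injectivity. *)
Lemma up_not_split m n (D : horoproduct m n X) u v v' : (1 < n)%N ->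
  (forall u v, neighbour D u v -> neighbour D (f u) (f v)) ->
  up D u v -> up D u v' -> up D (f u) (f v) -> ~ up D (f v') (f u).
Proof.
move=> n_gt1 fN uv uv' fuv fvu.
have [w [wu /fN wv /fN wv']] := common_neighbour n_gt1 uv uv'.
by apply: wu; apply: (can_inj fK); exact: unique_common_neighbour wv wv'.
Qed.

Lemma automorphism_orientation m n (D : horoproduct m n X) :
  (1 < m)%N -> (1 < n)%N ->
  (forall u v, neighbour D (f u) (f v) <-> neighbour D u v) ->
  (forall u v, up D u v -> up D (f u) (f v)) \/
  (forall u v, up D u v -> up D (f v) (f u)).
Proof.
move=> m_gt1 n_gt1 fN.
have fN1 u v : neighbour D u v -> neighbour D (f u) (f v) by move/fN.
have fN2 u v : neighbour (swap D) u v -> neighbour (swap D) (f u) (f v).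
  by rewrite !neighbour_swap; exact: fN1.
have splitU u v v' : up D u v -> up D u v' -> up D (f u) (f v) -> ~ up D (f v') (f u).
  exact: up_not_split n_gt1 fN1.
have splitD u v v' : up D v u -> up D v' u -> up D (f v) (f u) -> ~ up D (f u) (f v').
  move=> /up_swap uv /up_swap uv' /up_swap fuv /up_swap.
  exact: up_not_split m_gt1 fN2 uv uv' fuv.
pose keeps u := forall v, (up D u v -> up D (f u) (f v)) /\ (up D v u -> up D (f v) (f u)).
pose flips u := forall v, (up D u v -> up D (f v) (f u)) /\ (up D v u -> up D (f u) (f v)).
have local u : keeps u \/ flips u.
  have [v uv] := up_exists D u; have [w /up_swap wu] := up_exists (swap D) u.
  have nbU z : up D u z -> up D (f u) (f z) \/ up D (f z) (f u).
    by move=> uz; apply: (fN1 u z); left.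
  have nbD z : up D z u -> up D (f u) (f z) \/ up D (f z) (f u).
    by move=> uz; apply: (fN1 u z); right.
  (* The preimages of an upper and of a lower neighbour of [f u] prevent all neighbours of [u] from
     being sent to the same side. *)
  have [z0 fuz0] := up_exists D (f u); have [z1 /up_swap fuz1] := up_exists (swap D) (f u).
  have nz0 : neighbour D u (f' z0) by apply/fN; rewrite f'K; left.
  have nz1 : neighbour D u (f' z1) by apply/fN; rewrite f'K; right.
  have [fuv|fvu] := nbU v uv.
    have kU z : up D u z -> up D (f u) (f z).
      by move=> uz; case: (nbU z uz) => // /(splitU u v z uv uz fuv).
    have z1u : up D (f' z1) u.
      by case: nz1 => // uz1; have := kU _ uz1; rewrite f'K => e; case: (up_asym e).
    left=> z; split=> [/kU//|zu]; case: (nbD z zu) => // fuz.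
    by have := splitD u (f' z1) z z1u zu; rewrite f'K => /(_ fuz1 fuz).
  have kU z : up D u z -> up D (f z) (f u).
    by move=> uz; case: (nbU z uz) => // /(splitU u z v uz uv) /(_ fvu).
  have z0u : up D (f' z0) u.
    by case: nz0 => // uz0; have := kU _ uz0; rewrite f'K => e; case: (up_asym e).
  right=> z; split=> [/kU//|zu]; case: (nbD z zu) => // fzu.
  by have := splitD u z (f' z0) zu z0u fzu; rewrite f'K => /(_ fuz0).
(* An edge is seen from both its ends, so the behaviour of [f] cannot change along it; by
   connectedness it is the same everywhere. *)
have keeps_up u v : up D u v -> (keeps u <-> keeps v).
  move=> uv; split=> k.
    by case: (local v) => // fl; case: (up_asym ((k v).1 uv) ((fl u).2 uv)).
  by case: (local u) => // fl; case: (up_asym ((k u).2 uv) ((fl v).1 uv)).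
have [[u0 ku0]|nk] := pselect (exists u, keeps u).
  left=> u v; have ku : keeps u by apply: (up_connected keeps_up) ku0.
  exact: (ku v).1.
by right=> u v; case: (local u) => [ku|/(_ v)[]//]; case: nk; exists u.
Qed.

End Automorphism.

(** * Group actions on horocyclic products *)

Lemma common_ancestor q (H : horotree q) (I : eqType) (F : I -> H) (k : int) (s : seq I) :
  (forall i, i \in s -> lev (F i) = k) ->
  exists e y, forall i, i \in s -> iter e par (F i) = y.
Proof.
elim: s => [|i s IH] Fk; first by exists 0%N, (origin H).
have [j js|e [y ey]] := IH; first by apply: Fk; rewrite inE js orbT.
have yk : lev (iter e par (F i)) = lev y \/ s = [::].
  case: s {IH} Fk ey => [|j s] Fk ey; [by right | left].
  by rewrite -(ey j) ?mem_head // !lev_iter !Fk ?inE ?eqxx ?orbT.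
case: yk => [/par_join_lev[d dy]|->]; last first.
  by exists 0%N, (F i) => j; rewrite inE => /eqP ->.
exists (d + e)%N, (iter d par y) => j; rewrite iterD inE => /orP[/eqP->//|/ey->//].
Qed.

Lemma finite_range_section (X : choiceType) (T : choiceType) (F : X -> T) :
  finite_set (range F) -> exists s : seq X, forall x, exists2 y, y \in s & F y = F x.
Proof.
have [[x0]|nX] := pselect (inhabited X); last by exists [::] => x; case: nX.
move=> /finite_seqP[s Fs].
have /choice[g gP] : forall o, exists x, range F o -> F x = o.
  move=> o; have [[x _ <-]|no] := pselect (range F o); first by exists x.
  by exists x0.
exists (map g s) => x; exists (g (F x)); last by apply: gP; exists x.
by apply: map_f; have : range F (F x) by [exists x]; rewrite Fs.
Qed.

Section GroupAction.
Variables (m n : nat) (X : graph) (D : horoproduct m n X).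
Variables (G : topologicalGroupType) (A : graph_action G X).
Hypothesis m_gt1 : (1 < m)%N.
Hypothesis n_gt1 : (1 < n)%N.
Hypothesis adjE : forall u v : X, adj u v <-> neighbour D u v.
Implicit Types (g h t : G) (u v w : X).
Notation p1 := (@left _ _ _ D).
Notation p2 := (@right _ _ _ D).

Lemma actVK g u : A g^-1%g (A g u) = u.
Proof. by rewrite -actM mulVg act1. Qed.

Lemma actKV g u : A g (A g^-1%g u) = u.
Proof. by rewrite -actM mulgV act1. Qed.

Definition keeps g := forall u v, up D u v -> up D (A g u) (A g v).
Definition flips g := forall u v, up D u v -> up D (A g v) (A g u).

Lemma keeps_or_flips g : keeps g \/ flips g.
Proof.
apply: (automorphism_orientation (actVK g) (actKV g) m_gt1 n_gt1) => u v.
by rewrite -!adjE act_adj.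
Qed.

Lemma keeps_up g u v : up D u v -> up D (A g u) (A g v) -> keeps g.
Proof.
move=> uv guv; have [//|gf] := keeps_or_flips g.
by case: (up_asym guv (gf _ _ uv)).
Qed.

Lemma up_point : exists u v, up D u v.
Proof.
have [|u _] := @point_ex _ _ _ D (origin _) (origin _); first by rewrite !lev_origin.
by exists u; exact: up_exists.
Qed.

Lemma keepsNflips g : keeps g -> ~ flips g.
Proof.
have [u [v uv]] := up_point.
by move=> gk gf; exact: up_asym (gk _ _ uv) (gf _ _ uv).
Qed.

Lemma keeps1 : keeps 1%g.
Proof. by move=> u v; rewrite !act1. Qed.

Lemma keepsM g h : keeps g -> keeps h -> keeps (g * h)%g.
Proof. by move=> gk hk u v /hk /gk; rewrite !actM. Qed.

Lemma flipsM g h : flips g -> flips h -> keeps (g * h)%g.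
Proof. by move=> gk hk u v /hk /gk; rewrite !actM. Qed.

Lemma keepsMflips g h : keeps g -> flips h -> flips (g * h)%g.
Proof. by move=> gk hk u v /hk /gk; rewrite !actM. Qed.

Lemma flipsMkeeps g h : flips g -> keeps h -> flips (g * h)%g.
Proof. by move=> gk hk u v /hk /gk; rewrite !actM. Qed.

Lemma keepsV g : keeps g -> keeps g^-1%g.
Proof.
move=> gk; have [//|gf] := keeps_or_flips g^-1%g.
by have := keepsMflips gk gf; rewrite mulgV => /(keepsNflips keeps1).
Qed.

Lemma flipsV g : flips g -> flips g^-1%g.
Proof.
move=> gf; have [gk|//] := keeps_or_flips g^-1%g.
by have := flipsMkeeps gf gk; rewrite mulgV => /(keepsNflips keeps1).
Qed.

Lemma keeps_left g i j u v : keeps g ->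
  iter i par (p1 u) = iter j par (p1 v) ->
  iter i par (p1 (A g u)) = iter j par (p1 (A g v)).
Proof. by move=> gk /meet_upP /(meet_map gk) /meet_upP. Qed.

Lemma keeps_right g i j u v : keeps g ->
  iter i par (p2 u) = iter j par (p2 v) ->
  iter i par (p2 (A g u)) = iter j par (p2 (A g v)).
Proof.
move=> gk /(meet_upP (swap D)) e; apply/(meet_upP (swap D)).
by apply: (meet_map (f := A g)) e => a b /up_swap ab; apply/up_swap; exact: gk.
Qed.

Lemma flips_left g i j u v : flips g ->
  iter i par (p1 u) = iter j par (p1 v) ->
  iter i par (p2 (A g u)) = iter j par (p2 (A g v)).
Proof.
move=> gk /meet_upP e; apply/(meet_upP (swap D)).
by apply: (meet_map (f := A g)) e => a b ab; apply/up_swap; exact: gk.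
Qed.

Lemma flips_right g i j u v : flips g ->
  iter i par (p2 u) = iter j par (p2 v) ->
  iter i par (p1 (A g u)) = iter j par (p1 (A g v)).
Proof.
move=> gk /(meet_upP (swap D)) e; apply/meet_upP.
by apply: (meet_map (f := A g)) e => a b /up_swap ab; exact: gk.
Qed.

Notation ht := (lev_left D).

Lemma keeps_shift g : keeps g -> exists c : int, forall u, ht (A g u) = (ht u + c)%R.
Proof.
move=> gk; have [u0 _] := up_point.
exists (ht (A g u0) - ht u0)%R => u.
apply: (@up_connected _ _ _ D
  (fun w => ht (A g w) = ht w + (ht (A g u0) - ht u0))%R _ u0); last lia.
by move=> v w vw; have := lev_up vw; have := lev_up (gk _ _ vw); split; lia.
Qed.

Lemma flips_shift g : flips g -> exists c : int, forall u, ht (A g u) = (c - ht u)%R.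
Proof.
move=> gk; have [u0 _] := up_point.
exists (ht (A g u0) + ht u0)%R => u.
apply: (@up_connected _ _ _ D
  (fun w => ht (A g w) = (ht (A g u0) + ht u0) - ht w)%R _ u0); last lia.
by move=> v w vw; have := lev_up vw; have := lev_up (gk _ _ vw); split; lia.
Qed.

(** * Height translations and orbits of a cocompact action *)

Section Cocompact.
Hypothesis cocompact : cocompact_action A.

(** The direction-preserving elements have index at most 2 in the group, so it suffices to add to
    the orbit representatives their images under one reversing element. *)
Lemma keeps_representatives :
  exists s : seq X, forall w, exists r g, [/\ r \in s, keeps g & A g r = w].
Proof.
have [s sP] := finite_range_section cocompact.
have sA w : exists r g, r \in s /\ A g r = w.
  have [r rs] := sP w; move=> /(congr1 (fun S : set X => S w)) e.
  have [g _ gr] : Defs.orbit A r w by rewrite e; exists 1%g; rewrite ?act1.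
  by exists r, g.
have [[t tf]|nf] := pselect (exists t, flips t); last first.
  exists s => w; have [r [g [rs gr]]] := sA w; exists r, g; split=> //.
  by have [//|gf] := keeps_or_flips g; case: nf; exists g.
exists (s ++ map (A t) s) => w; have [r [g [rs gr]]] := sA w.
have [gk|gf] := keeps_or_flips g.
  by exists r, g; rewrite mem_cat rs.
exists (A t r), (g * t^-1)%g; rewrite mem_cat map_f ?orbT //; split=> //.
  exact/flipsM/flipsV.
by rewrite actM actVK.
Qed.

(** The height shifts form a subgroup of the integers, nonzero by cocompactness; l is its least
    positive element. *)
Lemma translation_length : exists l : nat, [/\ (0 < l)%N,
  forall g, keeps g -> exists k : int, forall u, ht (A g u) = (ht u + k * l%:Z)%R &
  forall k : int, exists2 g, keeps g & forall u, ht (A g u) = (ht u + k * l%:Z)%R].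
Proof.
pose shift (c : int) := exists2 g, keeps g & forall u, ht (A g u) = (ht u + c)%R.
have shiftD a b : shift a -> shift b -> shift (a + b)%R.
  move=> [g gk ga] [h hk hb]; exists (g * h)%g; first exact: keepsM.
  by move=> u; rewrite actM ga hb; lia.
have shiftN a : shift a -> shift (- a)%R.
  move=> [g gk ga]; exists g^-1%g; first exact: keepsV.
  by move=> u; have := ga (A g^-1%g u); rewrite actKV; lia.
have shiftM a (k : int) : shift a -> shift (k * a)%R.
  move=> sa; have shiftMn (i : nat) : shift (i%:Z * a)%R.
    elim: i => [|i IH].
      by exists 1%g => [|u]; [exact: keeps1 | rewrite act1; lia].
    have -> : (i.+1%:Z * a = a + i%:Z * a)%R by lia.
    exact: shiftD.
  case: (intP k) => [|i|i]; first exact: (shiftMn 0%N).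
    exact: shiftMn.
  by rewrite mulNr; apply/shiftN/shiftMn.
pose P l := (0 < l)%N && `[< shift (l%:Z)%R >].
have exP : exists l, P l.
  have [s sP] := keeps_representatives.
  (* A point of height b, above all representatives, is the image of one of them under a
     direction-preserving element, whose shift is therefore positive. *)
  have [b bP] : exists b : int, forall r, r \in s -> (ht r < b)%R.
    elim: s {sP} => [|r s [b bP]]; first by exists 0%R.
    exists (Num.max b (ht r + 1))%R => r'; rewrite inE => /orP[/eqP->|/bP]; lia.
  have [x xb] := lev_surj (left_tree D) b.
  have [y yb] := lev_surj (right_tree D) (- b)%R.
  have [|w [w1 _]] := @point_ex _ _ _ D x y; first by rewrite xb yb subrr.
  have [r [g [/bP rb gk gr]]] := sP w; have [c gc] := keeps_shift gk.
  have wb : ht w = b by rewrite /lev_left w1.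
  exists `|c|%N; have c0 : (0 < c)%R by have := gc r; rewrite gr wb; lia.
  apply/andP; split; first lia.
  by apply/asboolP; exists g => // u; rewrite gc; lia.
case: (ex_minnP exP) => l /andP[l0 /asboolP sl] lmin.
exists l; split=> // [g gk|k]; last exact: shiftM.
have [c gc] := keeps_shift gk; exists (c %/ l)%Z => u; rewrite gc; congr (_ + _)%R.
(* The remainder is a shift smaller than l, so it vanishes by minimality. *)
have sr : shift (c %% l)%Z.
  have -> : ((c %% l)%Z = c + - (c %/ l)%Z * l%:Z)%R by rewrite mulNr /modz.
  by apply: shiftD; [exists g | exact: shiftM].
have r0 : (0 <= (c %% l)%Z)%R by apply: modz_ge0; lia.
have rl : ((c %% l)%Z < l%:Z)%R by apply: ltz_pmod; lia.
rewrite [LHS](divz_eq c l).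
suff -> : (c %% l)%Z = 0%R by rewrite addr0.
apply/eqP; apply: contraT => rn0.
have : P `|(c %% l)%Z|%N.
  apply/andP; split; first lia.
  by apply/asboolP; have -> : (`|(c %% l)%Z|%N%:Z = (c %% l)%Z)%R by lia.
by move/lmin; lia.
Qed.

Lemma common_ancestor_orbits (l c : nat) :
  (forall g, keeps g -> exists k : int, forall u, ht (A g u) = (ht u + k * l%:Z)%R) ->
  (forall k : int, exists2 g, keeps g & forall u, ht (A g u) = (ht u + k * l%:Z)%R) ->
  exists s x0 y0, forall w, (l %| ht w)%Z ->
    exists g, [/\ keeps g, iter s par (p1 (A g w)) = x0 &
                           iter (s + c) par (p2 (A g w)) = y0].
Proof.
move=> lP tP; have [R RP] := keeps_representatives.
(* [N] translates each representative whose height is divisible by l to height 0; its value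
   elsewhere does not matter. *)
have /choice[N NP] : forall r, exists r', (l %| ht r)%Z ->
    ht r' = 0%R /\ exists2 g, keeps g & r' = A g r.
  move=> r; have [rl|] := boolP (l %| ht r)%Z; last by exists r.
  have [g gk gP] := tP (- (ht r %/ l)%Z)%R; exists (A g r) => _; split; last by exists g.
  by rewrite gP mulNr divzK // subrr.
pose R' := [seq r <- R | (l %| ht r)%Z].
have R'0 r : r \in R' -> ht (N r) = 0%R by rewrite mem_filter => /andP[/NP[]].
have [s1 [y1 h1]] := common_ancestor (F := fun r => p1 (N r)) R'0.
have [r /R'0 r0|s2 [y2 h2]] :=
  common_ancestor (F := fun r => p2 (N r)) (k := 0%R) (s := R').
  by rewrite lev_right -[lev _]/(ht _) r0 oppr0.
(* The finitely many [N r] merge after s1 steps on the left and s2 on the right. The sum serves both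
   sides, the surplus steps being applied to the merging points. *)
exists (s2 + s1)%N, (iter s2 par y1), (iter (s1 + c) par y2) => w wl.
have [r [g [rR gk gr]]] := RP w.
have rl : (l %| ht r)%Z.
  have [k /(_ r)] := lP g gk; rewrite gr => e; move: wl; rewrite e.
  by rewrite rpredDr // dvdz_mull.
have rR' : r \in R' by rewrite mem_filter rl.
have [_ [h hk e]] := NP r rl.
exists (h * g^-1)%g; rewrite actM -gr actVK -e; split.
- exact/keepsM/keepsV.
- by rewrite iterD h1.
- by rewrite -addnA addnC iterD h2.
Qed.

(** Two reversing elements differ by a direction-preserving one, so their constants agree modulo l;
    the residue is chosen to get a natural number. *)
Lemma flip_constant (l : nat) : (0 < l)%N ->
  (forall g, keeps g -> exists k : int, forall u, ht (A g u) = (ht u + k * l%:Z)%R) ->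
  exists c : nat, forall g, flips g ->
    exists k : int, forall u, ht (A g u) = (c%:Z + k * l%:Z - ht u)%R.
Proof.
move=> l0 lP; have [[t tf]|nf] := pselect (exists t, flips t); last first.
  by exists 0%N => g gf; case: nf; exists g.
have [a ta] := flips_shift tf; exists `|(a %% l)%Z|%N => g gf.
have [k kP] := lP _ (flipsM gf (flipsV tf)); exists (k + (a %/ l)%Z)%R => u.
have := kP (A t u); rewrite actM actVK ta => ->.
have r0 : (0 <= (a %% l)%Z)%R by apply: modz_ge0; lia.
by have := divz_eq a l; rewrite abszE ger0_norm //; lia.
Qed.

End Cocompact.

End GroupAction.

(** * Open and compact stabilizers *)

Section ContinuousSections.
Variables (U V W : topologicalType) (F : U * V -> W).

Lemma continuous_section_l u : continuous F -> continuous (fun v => F (u, v)).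
Proof.
move=> Fc v; apply: (@cvg_comp _ _ _ (pair u) F (nbhs v) (nbhs (u, v))); last exact: Fc.
by apply: cvg_pair; [exact: cvg_cst | exact: cvg_id].
Qed.

Lemma continuous_section_r v : continuous F -> continuous (fun u => F (u, v)).
Proof.
move=> Fc u; apply: (@cvg_comp _ _ _ (pair^~ v) F (nbhs u) (nbhs (u, v))); last exact: Fc.
by apply: cvg_pair; [exact: cvg_id | exact: cvg_cst].
Qed.

End ContinuousSections.

Section TopologicalGroup.
Variable G : topologicalGroupType.
Implicit Types (g h : G) (K : set G).

Lemma continuous_mull g : continuous (fun h => g * h)%g.
Proof. exact: (@continuous_section_l G G G (fun p => p.1 * p.2)%g g (@mulg_continuous G)). Qed.

Lemma continuous_mulr g : continuous (fun h => h * g)%g.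
Proof. exact: (@continuous_section_r G G G (fun p => p.1 * p.2)%g g (@mulg_continuous G)). Qed.

Lemma compact_mull g K : compact K -> compact ((fun h => g * h)%g @` K).
Proof.
move=> Kc; apply: continuous_compact => //; apply: continuous_subspaceT.
exact: continuous_mull.
Qed.

Lemma compact_mulr g K : compact K -> compact ((fun h => h * g)%g @` K).
Proof.
move=> Kc; apply: continuous_compact => //; apply: continuous_subspaceT.
exact: continuous_mulr.
Qed.

Lemma compact_bigcup_finite (I : choiceType) (F : I -> set G) (J : set I) :
  finite_set J -> (forall i, compact (F i)) -> compact (\bigcup_(i in J) F i).
Proof.
move=> /finite_seqP[s ->] Fc; rewrite bigcup_seq; exact: bigsetU_compact.
Qed.

End TopologicalGroup.

Section ActionTopology.
Variables (G : topologicalGroupType) (X : graph) (B : G -> X -> X).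
Hypothesis B1 : forall x, B 1%g x = x.
Hypothesis BM : forall g h x, B (g * h)%g x = B g (B h x).

(** Near (g, x) the map is constant on the product of the coset of g modulo the stabilizer of x with
    the open singleton x. *)
Lemma continuous_of_open_stabilizers :
  (forall x, open [set g | B g x = x]) ->
  continuous (fun p : G * discrete_topology X => B p.1 p.2 : discrete_topology X).
Proof.
move=> Bo [g x]; apply/(@discrete_cvg (discrete_topology X)).
exists ([set h | B (g^-1 * h)%g x = x], [set x]).
  split; last exact: (@discrete_set1 (discrete_topology X) x).
  have : nbhs (g^-1 * g)%g [set h | B h x = x].
    by apply: open_nbhs_nbhs; split; [exact: Bo | rewrite /= mulVg B1].
  exact: continuous_mull.
move=> [h y] [/= hx ->] /=.
by rewrite -[in RHS]hx -BM mulgA mulgV mul1g.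
Qed.

End ActionTopology.

Lemma open_stabilizer_of_sub (G : topologicalGroupType) (S K : set G) :
  open K -> K 1%g -> (forall g k, S g -> K k -> S (g * k)%g) -> open S.
Proof.
move=> Ko K1 SK; rewrite openE => g Sg.
have : nbhs g [set h | K (g^-1 * h)%g].
  apply: continuous_mull; apply: open_nbhs_nbhs; split=> //.
  by rewrite mulVg.
by apply: filterS => h /= /(SK _ _ Sg); rewrite mulgA mulgV mul1g.
Qed.

Lemma closed_stabilizer (G : topologicalGroupType) (X : graph)
  (A : graph_action G X) x : closed (stabilizer A x).
Proof.
have Ac := @continuous_section_r _ (discrete_topology X) (discrete_topology X)
  (fun p => A p.1 p.2) x (@act_continuous G X A).
have -> : stabilizer A x =
    (fun g => A g x : discrete_topology X) @^-1` [set x] by [].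
apply: closed_comp; last exact: (@discrete_closed (discrete_topology X)).
by move=> g _; exact: Ac.
Qed.

(** A descendant k generations below [x] is determined by its word of k labels. *)
Lemma finite_descendants q (H : horotree q) k (x : H) :
  finite_set [set y | iter k par y = x].
Proof.
have [g gP] : exists g : {ffun 'I_k -> 'I_q} -> H,
    forall y, iter k par y = x -> g (word k y) = y.
  have /choice[g gP] : forall w, exists z : H, forall y, iter k par y = x ->
      word k y = w -> z = y.
    move=> w; have [[y [yx yw]]|ny] :=
      pselect (exists y : H, iter k par y = x /\ word k y = w).
      exists y => z zx; rewrite -yw => /ffunP yz; apply: (word_inj (n := k)).
        by rewrite yx zx.
      by move=> i ik; have := yz (Ordinal ik); rewrite !ffunE.
    by exists x => y yx yw; case: ny; exists y.
  by exists g => y yx; exact: gP.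
apply: (@sub_finite_set _ _ [set g w | w in [set: {ffun 'I_k -> 'I_q}]]).
  by move=> y yx; exists (word k y) => //; rewrite gP.
exact/finite_image/finite_finset.
Qed.

Lemma finite_point_descendants m n (X : choiceType) (D : horoproduct m n X) i j x y :
  finite_set [set u : X | iter i par (@left _ _ _ D u) = x /\
                          iter j par (@right _ _ _ D u) = y].
Proof.
set S := mkset _; have [[u0 _]|S0] := pselect (exists u, S u); last first.
  rewrite (_ : S = set0) //; apply/seteqP; split=> // u Su; case: S0; by exists u.
have /choice[f fP] : forall p : left_tree D * right_tree D, exists u,
    forall v, left v = p.1 -> right v = p.2 -> v = u.
  move=> p; have [[u [u1 u2]]|np] :=
    pselect (exists u, @left _ _ _ D u = p.1 /\ @right _ _ _ D u = p.2).
    by exists u => v v1 v2; apply: (@point_eq _ _ _ D); rewrite ?u1 ?u2.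
  by exists u0 => v v1 v2; case: np; exists v.
apply: (@sub_finite_set _ _
  (f @` ([set z | iter i par z = x] `*` [set z | iter j par z = y]))).
  by move=> u [u1 u2]; exists (left u, right u) => //; rewrite -(fP (left u, right u) u).
apply/finite_image/finite_setX; exact: finite_descendants.
Qed.

(** * The induced action *)

Section InducedAction.
Variables (m n : nat) (X : graph) (D : horoproduct m n X).
Variables (G : topologicalGroupType) (A : graph_action G X).
Hypothesis m_gt1 : (1 < m)%N.
Hypothesis n_gt1 : (1 < n)%N.
Hypothesis adjE : forall u v : X, adj u v <-> neighbour D u v.
Implicit Types (g h t : G) (u v w : X).
Notation p1 := (@left _ _ _ D).
Notation p2 := (@right _ _ _ D).
Notation ht := (lev_left D).
Notation keeps := (keeps D A).
Notation flips := (flips D A).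
Let keeps_or_flips := keeps_or_flips A m_gt1 n_gt1 adjE.

Variables l c s : nat.
Hypothesis keeps_l : forall g, keeps g ->
  exists k : int, forall u, ht (A g u) = (ht u + k * l%:Z)%R.
Hypothesis flips_c : forall g, flips g ->
  exists k : int, forall u, ht (A g u) = (c%:Z + k * l%:Z - ht u)%R.

Variables (Y : graph) (e1 : Y -> left_tree D) (e2 : Y -> right_tree D).
Implicit Types z : Y.
Hypothesis e_inj : forall z z', e1 z = e1 z' -> e2 z = e2 z' -> z = z'.
Hypothesis e1_lev : forall z, (l %| (lev (e1 z) + s%:Z)%R)%Z.
Hypothesis e2_lev : forall z, (lev (e2 z) = - (s + (s + c))%N%:Z - lev (e1 z))%R.
Hypothesis e_ex : forall x y, (l %| (lev x + s%:Z)%R)%Z ->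
  (lev y = - (s + (s + c))%N%:Z - lev x)%R -> exists z, e1 z = x /\ e2 z = y.
(** The upward edges of [Y] read in the trees of [X]: one step is l generations. *)
Definition below z z' :=
  iter l par (e1 z') = e1 z /\ iter l par (e2 z) = e2 z'.
Hypothesis Y_adj : forall z z', adj z z' <-> below z z' \/ below z' z.

(* The points (x,y) of Y do not lie over points of X, so (x,y) is represented by
   any two points of X having x as left and y as right coordinate. *)
Definition represents (p : X * X) z := p1 p.1 = e1 z /\ p2 p.2 = e2 z.

(** A reversing element exchanges the trees, so the new left coordinate comes from the point that
    carried the right one. *)
Definition twist g (p : X * X) := if `[< keeps g >] then (A g p.1, A g p.2)
  else (A g p.2, A g p.1).

Lemma twist_keeps g p : keeps g -> twist g p = (A g p.1, A g p.2).
Proof. by move=> gk; rewrite /twist asboolT. Qed.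

Lemma twist_flips g p : flips g -> twist g p = (A g p.2, A g p.1).
Proof. by move=> gf; rewrite /twist asboolF // => /keepsNflips. Qed.

Lemma twist1 p : twist 1%g p = p.
Proof. by rewrite twist_keeps; [rewrite !act1; case: p | exact: keeps1]. Qed.

Lemma twistM g h p : twist (g * h)%g p = twist g (twist h p).
Proof.
have [gk|gf] := keeps_or_flips g; have [hk|hf] := keeps_or_flips h.
- by rewrite !twist_keeps ?actM //; exact: keepsM.
- rewrite [RHS]twist_keeps // !twist_flips ?actM //; exact: keepsMflips.
- rewrite [twist h p]twist_keeps // !twist_flips ?actM //; exact: flipsMkeeps.
- rewrite [LHS]twist_keeps; last exact: flipsM.
  by rewrite !twist_flips ?actM.
Qed.

Lemma represents_inj p z z' : represents p z -> represents p z' -> z = z'.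
Proof. by move=> [h1 h2] [h1' h2']; apply: e_inj; rewrite -?h1 -?h2. Qed.

Lemma represents_total z : exists p, represents p z.
Proof.
have [y y1] := lev_surj (right_tree D) (- lev (e1 z))%R.
have [x x1] := lev_surj (left_tree D) (- lev (e2 z))%R.
have [|u [u1 _]] := @point_ex _ _ _ D (e1 z) y; first by rewrite y1 subrr.
have [|v [_ v2]] := @point_ex _ _ _ D x (e2 z); first by rewrite x1 addNr.
by exists (u, v).
Qed.

(** Points sharing a coordinate have images sharing the corresponding coordinate, so the result does
    not depend on the representing pair; the congruences on shifts put it back in [Y]. *)
Lemma twist_represents g z : exists z', forall p, represents p z -> represents (twist g p) z'.
Proof.
have [[u v] [/= u1 v2]] := represents_total z.
have zl := e1_lev z; have zl2 := e2_lev z.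
have hu : ht u = lev (e1 z) by rewrite -u1.
have hv : ht v = (- lev (e2 z))%R by rewrite -v2 lev_right opprK.
have [gk|gf] := keeps_or_flips g.
  have [k kP] := keeps_l gk.
  have [||z' [z1 z2]] := @e_ex (p1 (A g u)) (p2 (A g v)).
  - rewrite -/(ht _) kP hu addrAC rpredDr // dvdz_mull //.
  - rewrite lev_right -!/(ht _) !kP; lia.
  exists z' => -[u' v'] [/= u1' v2']; rewrite twist_keeps //=; split=> /=.
    by rewrite z1; apply: (keeps_left (i := 0) (j := 0) gk); rewrite /= u1 u1'.
  by rewrite z2; apply: (keeps_right (i := 0) (j := 0) gk); rewrite /= v2 v2'.
have [k kP] := flips_c gf.
have [||z' [z1 z2]] := @e_ex (p1 (A g v)) (p2 (A g u)).
- rewrite -/(ht _) kP hv zl2.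
  (* Here the offset s + c on the right pays off: c cancels and the left level stays congruent to -s
     modulo l. *)
  have -> : (c%:Z + k * l%:Z - - (- (s + (s + c))%N%:Z - lev (e1 z)) + s%:Z
    = k * l%:Z - (lev (e1 z) + s%:Z))%R by lia.
  by rewrite rpredB // dvdz_mull.
- rewrite lev_right -!/(ht _) !kP; lia.
exists z' => -[u' v'] [/= u1' v2']; rewrite twist_flips //=; split=> /=.
  by rewrite z1; apply: (flips_right (i := 0) (j := 0) gf); rewrite /= v2 v2'.
by rewrite z2; apply: (flips_left (i := 0) (j := 0) gf); rewrite /= u1 u1'.
Qed.

Definition induced g z : Y := projT1 (cid (twist_represents g z)).

Lemma induced_represents g z p : represents p z -> represents (twist g p) (induced g z).
Proof. exact: (projT2 (cid (twist_represents g z))). Qed.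

Lemma induced1 z : induced 1%g z = z.
Proof.
have [p pz] := represents_total z; apply: (represents_inj _ pz).
by rewrite -[p]twist1; exact: induced_represents.
Qed.

Lemma inducedM g h z : induced (g * h)%g z = induced g (induced h z).
Proof.
have [p pz] := represents_total z.
apply: (@represents_inj (twist (g * h)%g p)); first exact: induced_represents.
by rewrite twistM; do 2 apply: induced_represents.
Qed.

Lemma induced_below g z z' : below z z' ->
  below (induced g z) (induced g z') \/ below (induced g z') (induced g z).
Proof.
have [p pz] := represents_total z; have [p' pz'] := represents_total z'.
have [r1 r2] := induced_represents g pz; have [r1' r2'] := induced_represents g pz'.
rewrite /below -r1 -r2 -r1' -r2' -pz.1 -pz.2 -pz'.1 -pz'.2 => -[b1 b2].
have [gk|gf] := keeps_or_flips g; [left|right].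
  rewrite !twist_keeps //=; split.
    exact: (keeps_left (j := 0) gk b1).
  exact: (keeps_right (j := 0) gk b2).
rewrite !twist_flips //=; split.
  exact: (flips_right (j := 0) gf b2).
exact: (flips_left (j := 0) gf b1).
Qed.

Lemma induced_adj g z z' : adj (induced g z) (induced g z') = adj z z'.
Proof.
have adjP h x y : adj x y -> adj (induced h x) (induced h y).
  by move=> /Y_adj[/(induced_below h)|/(induced_below h)]; rewrite Y_adj => -[]; auto.
apply/idP/idP => [/(adjP g^-1%g)|]; last exact: adjP.
by rewrite -!inducedM mulVg !induced1.
Qed.

Lemma point_over z : exists w,
  [/\ iter s par (p1 w) = e1 z, iter (s + c) par (p2 w) = e2 z & (l %| ht w)%Z].
Proof.
have [x xs] := descendant s (e1 z); have [y ys] := descendant (s + c) (e2 z).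
have xl : (lev (e1 z) = lev x - s%:Z)%R by rewrite -xs lev_iter.
have yl : (lev (e2 z) = lev y - (s + c)%N%:Z)%R by rewrite -ys lev_iter.
have [|w [w1 w2]] := @point_ex _ _ _ D x y; first by have := e2_lev z; lia.
exists w; rewrite w1 w2 /lev_left w1; split=> //.
by have := e1_lev z; rewrite xl subrK.
Qed.

Lemma induced_keeps g z w : keeps g ->
  iter s par (p1 w) = e1 z -> iter (s + c) par (p2 w) = e2 z ->
  iter s par (p1 (A g w)) = e1 (induced g z) /\
  iter (s + c) par (p2 (A g w)) = e2 (induced g z).
Proof.
move=> gk w1 w2; have [p pz] := represents_total z.
have [<- <-] := induced_represents g pz; rewrite twist_keeps //=; split.
  by apply: (keeps_left (j := 0) gk); rewrite w1 -pz.1.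
by apply: (keeps_right (j := 0) gk); rewrite w2 -pz.2.
Qed.

(** Every point of [Y] lies under some [w] of height divisible by l, and moving [w] brings it to the
    one point with coordinates [x0] and [y0]. *)
Lemma induced_transitive x0 y0 :
  (forall w, (l %| ht w)%Z -> exists g, [/\ keeps g,
    iter s par (p1 (A g w)) = x0 & iter (s + c) par (p2 (A g w)) = y0]) ->
  forall z z', exists g, induced g z = z'.
Proof.
move=> wP; have toz z : exists g, e1 (induced g z) = x0 /\ e2 (induced g z) = y0.
  have [w [w1 w2 wl]] := point_over z; have [g [gk g1 g2]] := wP w wl.
  by exists g; have [<- <-] := induced_keeps gk w1 w2.
move=> z z'; have [g [g1 g2]] := toz z; have [h [h1 h2]] := toz z'.
exists (h^-1 * g)%g; rewrite inducedM.
have -> : induced g z = induced h z' by apply: e_inj; rewrite ?g1 ?g2 ?h1 ?h2.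
by rewrite -inducedM mulVg induced1.
Qed.

Hypothesis A_proper : proper_action A.

Lemma induced_stabilizer_open z : open [set g | induced g z = z].
Proof.
have [w [w1 w2 _]] := point_over z; have [w' ww'] := up_exists D w.
(* Fixing the edge from [w] to [w'] forces the direction to be preserved; fixing [w] then fixes the
   pair [z] of its ancestors. *)
apply: (@open_stabilizer_of_sub _ _ (stabilizer A w `&` stabilizer A w')).
- by apply: openI; apply: (A_proper _).2.
- by split; rewrite /stabilizer /= act1.
move=> g k /= gz [kw kw']; rewrite inducedM.
have kk : keeps k.
  by apply: (keeps_up m_gt1 n_gt1 adjE ww'); rewrite kw kw'.
have [h1 h2] := induced_keeps kk w1 w2.
suff -> : induced k z = z by [].
by apply: e_inj; rewrite -?h1 -?h2 kw.
Qed.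

Definition induced_action : graph_action G Y :=
  GraphAction induced1 inducedM induced_adj
    (continuous_of_open_stabilizers induced1 inducedM induced_stabilizer_open).

Lemma transporter_compact w w' : compact [set g | A g w = w'].
Proof.
have [[h hw]|nh] := pselect (exists h, A h w = w'); last first.
  rewrite (_ : mkset _ = set0); first exact: compact0.
  by apply/seteqP; split=> // g gw; case: nh; exists g.
rewrite (_ : mkset _ = (fun k => h * k)%g @` stabilizer A w).
  exact/compact_mull/(A_proper w).1.
apply/seteqP; split=> [g /= gw|_ [k kw <-]]; last by rewrite /= actM kw.
exists (h^-1 * g)%g; last by rewrite mulgA mulgV mul1g.
by rewrite /stabilizer /= actM gw -hw -actM mulVg act1.
Qed.

(* The elements of the stabilizer preserving the direction permute the finitely
   many points over z; the remaining ones form at most one more coset. *)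
Lemma induced_proper : proper_action induced_action.
Proof.
move=> z; split; last exact: induced_stabilizer_open.
have [w [w1 w2 _]] := point_over z.
pose J := [set u : X | iter s par (p1 u) = e1 z /\ iter (s + c) par (p2 u) = e2 z].
pose K := \bigcup_(u in J) [set g | A g w = u].
have Kc : compact K.
  apply: compact_bigcup_finite => [|u]; first exact: finite_point_descendants.
  exact: transporter_compact.
have KP g : keeps g -> induced g z = z -> K g.
  move=> gk gz; exists (A g w) => //.
  by have := induced_keeps gk w1 w2; rewrite gz.
have stab_closed := @closed_stabilizer _ _ induced_action z.
have [[t [tf tz]]|nt] := pselect (exists t, flips t /\ induced t z = z).
  (* The stabilizer is closed and contained in the union of [K] and its right translate by [t], both
     compact. *)
  refine (subclosed_compact stab_closed (compactU Kc (compact_mulr (g := t) Kc)) _).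
  move=> g gz; have [gk|gf] := keeps_or_flips g; first by left; apply: KP.
  right; exists (g * t^-1)%g; last by rewrite -mulgA mulVg mulg1.
  apply: KP; first exact/flipsM/(flipsV m_gt1 n_gt1 adjE).
  have tVz : induced t^-1%g z = z by rewrite -{1}tz -inducedM mulVg induced1.
  by rewrite inducedM tVz.
refine (subclosed_compact stab_closed Kc _) => g gz.
have [gk|gf] := keeps_or_flips g; first exact: KP.
by case: nt; exists g.
Qed.

End InducedAction.

(** * Diestel-Leader graphs as horocyclic products, and the conclusion *)

Section DLHoroproduct.
Variables (m n : nat) (T : ended_tree m) (T' : ended_tree n).

Let DL_left (u : DL T T') : horotree_of T := (val u).1.
Let DL_right (u : DL T T') : horotree_of T' := (val u).2.

Let DL_lev u : lev (DL_right u) = (- lev (DL_left u))%R.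
Proof. by apply/eqP; rewrite -addr_eq0 addrC; exact: (valP u). Qed.

Let DL_eq u v : DL_left u = DL_left v -> DL_right u = DL_right v -> u = v.
Proof.
case: u v => [[x y] xy] [[x' y'] xy'] e e'.
by apply: val_inj; congr pair; [exact: e | exact: e'].
Qed.

Let DL_ex x y : (lev x + lev y = 0)%R -> exists u, DL_left u = x /\ DL_right u = y.
Proof. by move=> /eqP xy; exists (exist _ (x, y) xy). Qed.

Definition DL_horoproduct : horoproduct m n (DL T T') := Horoproduct DL_lev DL_eq DL_ex.

Lemma DL_adjE (u v : DL T T') : adj u v <-> neighbour DL_horoproduct u v.
Proof.
(* The two levels sum to 0, so both coordinates cannot move towards their ends at once. *)
have level (w w' : DL T T') :
    par (DL_left w) = DL_left w' -> par (DL_right w) = DL_right w' -> False.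
  move=> /(congr1 lev) + /(congr1 lev); rewrite !lev_par !DL_lev; lia.
split=> [/andP[/adj_parent a1 /adj_parent a2]|[[h1 h2]|[h1 h2]]].
- case: a1 a2 => [a1|a1] [a2|a2].
  + by case: (@level u v).
  + by right; split.
  + by left; split.
  + by case: (@level v u).
- by apply/andP; split; apply/adj_parent; [right|left].
- by apply/andP; split; apply/adj_parent; [left|right].
Qed.

End DLHoroproduct.

Theorem proposition2p4 (m n : nat) (hm : (2 <= m)%N) (hn : (2 <= n)%N)
    (Tm : ended_tree m) (Tn : ended_tree n)
    (G : topologicalGroupType) (hG : locally_compact [set: G])
    (A : graph_action G (DL Tm Tn))
    (hproper : proper_action A) (hcocompact : cocompact_action A) :
  exists d : nat, (0 < d)%N /\
    forall (Tmd : ended_tree (m ^ d)%N) (Tnd : ended_tree (n ^ d)%N),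
      exists B : graph_action G (DL Tmd Tnd),
        proper_action B /\ transitive_action B.
Proof.
pose D := DL_horoproduct Tm Tn.
have adjE := @DL_adjE _ _ Tm Tn.
have [l [l0 keeps_l shifts]] := translation_length (D := D) hm hn adjE hcocompact.
have [c flips_c] := flip_constant hm hn adjE l0 keeps_l.
have [s [x0 [y0 orbits]]] := common_ancestor_orbits hm hn adjE hcocompact c keeps_l shifts.
(* The exponent is the translation length; the two given trees are then placed on the levels -s and
   -(s + c) modulo l. *)
exists l; split=> // Tmd Tnd.
have [f1 [f1i f1s f1p f1l]] :=
  skeleton_embedding (horotree_of Tm) (horotree_of Tmd) (- s%:Z)%R l0.
have [f2 [f2i f2s f2p f2l]] :=
  skeleton_embedding (horotree_of Tn) (horotree_of Tnd) (- (s + c)%N%:Z)%R l0.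
pose D' := DL_horoproduct Tmd Tnd.
pose e1 (z : DL Tmd Tnd) := f1 (@left _ _ _ D' z).
pose e2 (z : DL Tmd Tnd) := f2 (@right _ _ _ D' z).
have e_inj z z' : e1 z = e1 z' -> e2 z = e2 z' -> z = z'.
  by move=> /f1i h1 /f2i h2; apply: (@point_eq _ _ _ D').
have e1_lev z : (l %| (lev (e1 z) + s%:Z)%R)%Z.
  by rewrite f1l addrAC addNr add0r dvdz_mull.
have e2_lev z : (lev (e2 z) = - (s + (s + c))%N%:Z - lev (e1 z))%R.
  have e1l : lev (e1 z) = (- s%:Z + lev (@left _ _ _ D' z) * l%:Z)%R := f1l _.
  have e2l : lev (e2 z) = (- (s + c)%N%:Z + lev (@right _ _ _ D' z) * l%:Z)%R := f2l _.
  by rewrite e1l e2l lev_right; lia.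
have e_ex x y : (l %| (lev x + s%:Z)%R)%Z ->
    (lev y = - (s + (s + c))%N%:Z - lev x)%R -> exists z, e1 z = x /\ e2 z = y.
  move=> xl xy; have [|x' xx'] := f1s x; first by rewrite opprK.
  have [|y' yy'] := f2s y.
    have -> : (lev y - - (s + c)%N%:Z = - (lev x + s%:Z))%R by lia.
    by rewrite rpredN.
  have [|z [z1 z2]] := @point_ex _ _ _ D' x' y'.
    have := f1l x'; have := f2l y'; rewrite xx' yy' xy => h1 h2.
    (* The offsets -s and -(s + c) add up to the prescribed level sum, so the levels in the two
       smaller trees sum to 0 after division by l. *)
    have : ((lev x' + lev y') * l%:Z = 0)%R by lia.
    by move/eqP; rewrite mulf_eq0 => /orP[/eqP//|/eqP]; lia.
  by exists z; rewrite /e1 /e2 z1 z2.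
have Y_adj (z z' : DL Tmd Tnd) :
    adj z z' <-> below (D := D) l e1 e2 z z' \/ below (D := D) l e1 e2 z' z.
  have upE (u v : DL Tmd Tnd) : up D' u v <-> below (D := D) l e1 e2 u v.
    rewrite /up /below /e1 /e2 -f1p -f2p.
    by split=> -[h1 h2]; split; [rewrite h1|rewrite h2|exact: f1i|exact: f2i].
  by rewrite DL_adjE /neighbour !upE.
exists (induced_action hm hn adjE keeps_l flips_c e_inj e1_lev e2_lev e_ex Y_adj hproper).
split; first exact: induced_proper.
exact: induced_transitive orbits.
Qed.
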